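(* The Suslin functional $S$ is uniformly computable in Feferman's $\mu$ and any functional $\Xi$ satisfying $\mathsf{LIN}(\Xi)$. Furthermore, the system $\mathsf{ACA}_0^\omega+(\exists\Xi)\mathsf{LIN}(\Xi)$ proves $(S^2)$.
   Context: The metatheory is $\mathsf{ZFC}$, and ''computable'' means computable by Kleene's schemes S1–S9 for higher-order computation over the finite types. Language and base theory. Finite types: $0$ (natural numbers) is a type, and if $\sigma,\tau$ are types then so is $\sigma\to\tau$ (mappings); $1:=0\to 0$ and $n+1:=n\to 0$; $\rho^*$ is the type of finite sequences of type-$\rho$ objects (suitably coded). Superscripts on variables indicate types. $\mathsf{L}_\omega$ is the language with variables of all finite types, constants $0,1,<_0,+_0,\times_0,=_0$, the combinators and recursors. Equality $=_\tau$ and $\leq_\tau$ at type $\tau=\tau_1\to\dots\to\tau_k\to 0$ are defined pointwise from $=_0$, $\leq_0$. Quantifier-free formulas may contain variables of any type. The axiom $\mathsf{QF\text{-}AC}^{\sigma,\tau}$ is $(\forall x^\sigma)(\exists y^\tau)A(x,y)\to(\exists Y^{\sigma\to\tau})(\forall x^\sigma)A(x,Y(x))$ for all quantifier-free $A$. The (classical) system $\mathsf{RCA}_0^\omega$ consists of: the ordered semi-ring axioms for $0,1,<_0,+_0,\times_0$; the defining axioms of the $\Pi$ and $\Sigma$ (i.e. $K$ and $S$) combinators, yielding $\lambda$-abstraction; the recursor $\mathbf{R}_0$ with $\mathbf{R}_0(f,m,0)=m$ and $\mathbf{R}_0(f,m,n+1)=f(\mathbf{R}_0(f,m,n))$ for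 $m^0,f^1$; the axiom of extensionality $x=_\rho y\to\varphi(x)=_\tau\varphi(y)$ for all types $\rho,\tau$; induction for quantifier-free formulas; and $\mathsf{QF\text{-}AC}^{1,0}$. The axiom $(\mu^2)$ is $(\exists\mu^2)(\forall f^1)\big[(\exists n)(f(n)=0)\to f(\mu(f))=0\big]$ (such $\mu$ is called Feferman's $\mu$), and $\mathsf{ACA}_0^\omega:=\mathsf{RCA}_0^\omega+(\mu^2)$. Write $\overline{g}n=\langle g(0),\dots,g(n-1)\rangle$, and let $[\sigma]$ be the set of all $g\in\mathbb{N}^{\mathbb{N}}$ extending the finite sequence $\sigma$. The axiom $(S^2)$ is $(\exists S^2\leq_2 1)(\forall f^1)\big[(\exists g^1)(\forall n^0)(f(\overline{g}n)=0)\leftrightarrow S(f)=0\big]$; this $S$ is the Suslin functional. For $\Xi^{2\to(0\to1)}$, $\mathsf{LIN}(\Xi)$ is the formula $(\forall\Psi^2)(\forall g^1)(\exists n^0)\big(g\in\big[\overline{\Xi(\Psi)(n)}\,\Psi(\Xi(\Psi)(n))\big]\big)$. *)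

(* Defs.v *)
From Stdlib Require List.
From mathcomp Require Import all_boot.

Set Implicit Arguments.
Unset Strict Implicit.
Unset Printing Implicit Defensive.

Inductive ty : Type := ty0 | Arr of ty & ty.

Declare Scope ty_scope.
Bind Scope ty_scope with ty.
Delimit Scope ty_scope with ty.
Infix "⇾" := Arr (at level 55, right associativity) : ty_scope.
Local Open Scope ty_scope.

Notation ty1 := (ty0 ⇾ ty0).
Notation ty2 := (ty1 ⇾ ty0).
Notation tyLIN := (ty2 ⇾ ty0 ⇾ ty1).

(* The full type structure over the natural numbers. *)
Fixpoint itp (t : ty) : Type :=
  match t with
  | ty0 => nat
  | s ⇾ u => itp s -> itp u
  end.

(* An injective (not surjective) pairing, since (x + y)^2 is the largest square
   below it.  It is a polynomial, hence available as a term of L_omega, so that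
   the same coding serves inside and outside the formal system. *)
Definition pr (x y : nat) : nat := (x + y) * (x + y) + y.

Definition code (s : seq nat) : nat := foldl (fun c x => (pr c x).+1) 0 s.

Lemma pr_inj x y x' y' : pr x y = pr x' y' -> x = x' /\ y = y'.
Proof.
have ltpr a b c d : a + b < c + d -> pr a b < pr c d.
  move=> lt; apply: leq_trans (leq_addr _ _).
  apply: (@leq_trans ((a + b).+1 * (a + b).+1)); last exact: leq_mul.
  rewrite /pr mulSn mulnS addnA [ltnRHS]addnC ltn_add2l addSn ltnS.
  exact: leq_trans (leq_addl a b) (leq_addr _ _).
move=> e; have es : x + y = x' + y'.
  by case: (ltngtP (x + y) (x' + y')) => // /ltpr; rewrite e ltnn.
move: e es; rewrite /pr => + es; rewrite es => /addnI ey.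
by move: es; rewrite ey => /addIn.
Qed.

Lemma code_inj : injective code.
Proof.
have codeR s x : code (rcons s x) = (pr (code s) x).+1.
  by rewrite /code -cats1 foldl_cat.
elim/last_ind=> [|s x IHs]; elim/last_ind=> [|t y _] //; rewrite ?codeR //.
by case=> /pr_inj [/IHs -> ->].
Qed.

Definition obj : Type := {t : ty & itp t}.
Definition Obj (t : ty) (x : itp t) : obj := existT itp t x.
Arguments Obj t x : clear implicits.
Definition num (n : nat) : obj := Obj ty0 n.

(* [app_to F l n]: the list l supplies exactly all the arguments of F, with
   matching types, and F applied to them has value n. *)
Inductive app_to : forall t, itp t -> seq obj -> nat -> Prop :=
| app_to0 n : @app_to ty0 n [::] n
| app_toS s t (F : itp (s ⇾ t)) (x : itp s) l n :
    @app_to t (F x) l n -> @app_to (s ⇾ t) F (Obj s x :: l) n.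

(* [kleene e Phi n] is {e}(Phi) = n, for a list Phi of arguments of arbitrary
   finite types.  In [S8], F : t_1 -> ... -> t_k -> 0 and
     {<8, d_1, ..., d_k>}(F, Phi)
       = F (lambda y. {d_1}(y, F, Phi)) ... (lambda y. {d_k}(y, F, Phi)),
   where in the i-th position y ranges over the lists of arguments of a type
   t_i object; as in Kleene's scheme these functions must be total.  For F of
   pure type this is the usual S8. *)
Inductive kleene : nat -> seq obj -> nat -> Prop :=
| S1 x Phi :
    kleene (code [:: 1]) (num x :: Phi) x.+1
| S2 q Phi :
    kleene (code [:: 2; q]) Phi q
| S3 x Phi :
    kleene (code [:: 3]) (num x :: Phi) x
| S4 e0 e1 x n Phi :
    kleene e1 Phi x -> kleene e0 (num x :: Phi) n ->
    kleene (code [:: 4; e0; e1]) Phi n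
| S5_0 e0 e1 n Phi :
    kleene e0 Phi n ->
    kleene (code [:: 5; e0; e1]) (num 0 :: Phi) n
| S5_S e0 e1 x r n Phi :
    kleene (code [:: 5; e0; e1]) (num x :: Phi) r ->
    kleene e1 (num x :: num r :: Phi) n ->
    kleene (code [:: 5; e0; e1]) (num x.+1 :: Phi) n
| S6 d (p : seq nat) n Phi :
    perm_eq p (iota 0 (size Phi)) ->
    kleene d [seq nth (num 0) Phi i | i <- p] n ->
    kleene (code [:: 6, d & p]) Phi n
| S7 (f : itp ty1) x Phi :
    kleene (code [:: 7]) (Obj ty1 f :: num x :: Phi) (f x)
| S8 t (F : itp t) (ds : seq nat) (Gs : seq obj) n Phi :
    size ds = size Gs ->
    (forall i, i < size Gs ->
       forall (y : seq obj) m, app_to (projT2 (nth (num 0) Gs i)) y m ->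
         kleene (nth 0 ds i) (y ++ Obj t F :: Phi) m) ->
    app_to F Gs n ->
    kleene (code (8 :: ds)) (Obj t F :: Phi) n
| S9 m e n Phi :
    m <= size Phi ->
    kleene e (take m Phi) n ->
    kleene (code [:: 9; m]) (num e :: Phi) n.

Definition initseg (g : itp ty1) (n : nat) : seq nat := mkseq g n.

Definition cyl (sigma : seq nat) (g : itp ty1) : Prop :=
  forall i, i < size sigma -> g i = nth 0 sigma i.

Definition is_mu (mu : itp ty2) : Prop :=
  forall f : itp ty1, (exists n, f n = 0) -> f (mu f) = 0.

Definition is_Suslin (Su : itp ty2) : Prop :=
  (forall f, Su f <= 1) /\
  forall f : itp ty1,
    (exists g : itp ty1, forall n, f (code (initseg g n)) = 0) <-> Su f = 0.

Definition LIN (Xi : itp tyLIN) : Prop :=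
  forall (Psi : itp ty2) (g : itp ty1),
  exists n, cyl (initseg (Xi Psi n) (Psi (Xi Psi n))) g.

(* Intrinsically typed de Bruijn syntax: a context lists the types of the free
   variables, the most recently bound one first. *)
Inductive var : seq ty -> ty -> Type :=
| V0 G t : var (t :: G) t
| VS G t u : var G t -> var (u :: G) t.
Arguments V0 {G t}.
Arguments VS {G t u} x.

Inductive tm (G : seq ty) : ty -> Type :=
| Var t : var G t -> tm G t
| App s t : tm G (s ⇾ t) -> tm G s -> tm G t
| Zero : tm G ty0
| One : tm G ty0
| Plus : tm G (ty0 ⇾ ty0 ⇾ ty0)
| Times : tm G (ty0 ⇾ ty0 ⇾ ty0)
| Pi s t : tm G (s ⇾ t ⇾ s)
| Sigma s t u : tm G ((s ⇾ t ⇾ u) ⇾ (s ⇾ t) ⇾ s ⇾ u)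
| Rec : tm G (ty1 ⇾ ty0 ⇾ ty0 ⇾ ty0).
Arguments Zero {G}.
Arguments One {G}.
Arguments Plus {G}.
Arguments Times {G}.
Arguments Pi {G} s t.
Arguments Sigma {G} s t u.
Arguments Rec {G}.

Inductive fm (G : seq ty) : Type :=
| Eq of tm G ty0 & tm G ty0
| Lt of tm G ty0 & tm G ty0
| Bot
| Imp of fm G & fm G
| And of fm G & fm G
| Or of fm G & fm G
| All t of fm (t :: G)
| Ex t of fm (t :: G).
Arguments Bot {G}.
Arguments All {G} t A.
Arguments Ex {G} t A.

Declare Scope Lomega_scope.
Delimit Scope Lomega_scope with Lo.
Infix "⋅" := App (at level 39, left associativity) : Lomega_scope.
Notation "x ⊕ y" := (Plus ⋅ x ⋅ y)%Lo
  (at level 50, left associativity) : Lomega_scope.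
Notation "x ⊗ y" := (Times ⋅ x ⋅ y)%Lo
  (at level 40, left associativity) : Lomega_scope.
Infix "≐" := Eq (at level 70) : Lomega_scope.
Infix "≺" := Lt (at level 70) : Lomega_scope.
Infix "⩓" := And (at level 80, right associativity) : Lomega_scope.
Infix "⩔" := Or (at level 85, right associativity) : Lomega_scope.
Infix "⊃" := Imp (at level 90, right associativity) : Lomega_scope.
Local Open Scope Lomega_scope.

Definition Iff G (A B : fm G) : fm G := (A ⊃ B) ⩓ (B ⊃ A).

Fixpoint qf G (A : fm G) : bool :=
  match A with
  | Eq _ _ | Lt _ _ | Bot => true
  | Imp A B | And A B | Or A B => qf A && qf B
  | All _ _ | Ex _ _ => false
  end.

Definition sub (G D : seq ty) : Type := forall t, var G t -> tm D t.

Fixpoint tsub G D (sg : sub G D) t (a : tm G t) : tm D t :=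
  match a with
  | Var _ x => sg _ x
  | App _ _ a b => tsub sg a ⋅ tsub sg b
  | Zero => Zero
  | One => One
  | Plus => Plus
  | Times => Times
  | Pi s t => Pi s t
  | Sigma s t u => Sigma s t u
  | Rec => Rec
  end.

Definition shift G u : sub G (u :: G) := fun t x => Var (VS x).

Definition twk G u t (a : tm G t) : tm (u :: G) t := tsub (@shift G u) a.

Definition scons G D u (a : tm D u) (sg : sub G D) : sub (u :: G) D :=
  fun t x =>
    match x in var L t
      return match L with
             | [::] => unit
             | u :: G => tm D u -> sub G D -> tm D t
             end
    with
    | V0 _ _ => fun a _ => a
    | VS _ _ _ y => fun _ sg => sg _ y
    end a sg.

Definition up G D u (sg : sub G D) : sub (u :: G) (u :: D) :=
  scons (Var V0) (fun t x => twk u (sg t x)).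

Fixpoint fsub G D (sg : sub G D) (A : fm G) : fm D :=
  match A with
  | Eq a b => tsub sg a ≐ tsub sg b
  | Lt a b => tsub sg a ≺ tsub sg b
  | Bot => Bot
  | Imp A B => fsub sg A ⊃ fsub sg B
  | And A B => fsub sg A ⩓ fsub sg B
  | Or A B => fsub sg A ⩔ fsub sg B
  | All t A => All t (fsub (up sg) A)
  | Ex t A => Ex t (fsub (up sg) A)
  end.

Definition fwk G u (A : fm G) : fm (u :: G) := fsub (@shift G u) A.

Definition inst G u (A : fm (u :: G)) (a : tm G u) : fm G :=
  fsub (scons a (fun t x => Var x)) A.

Fixpoint pointwise (R : forall G, tm G ty0 -> tm G ty0 -> fm G) t :
    forall G, tm G t -> tm G t -> fm G :=
  match t with
  | ty0 => R
  | s ⇾ u => fun G a b =>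
      All s (pointwise R (twk s a ⋅ Var V0) (twk s b ⋅ Var V0))
  end.

Definition eqT t G (a b : tm G t) : fm G := pointwise Eq a b.

Definition le0 G (a b : tm G ty0) : fm G := a ≺ b ⩔ a ≐ b.
Definition leT t G (a b : tm G t) : fm G := pointwise le0 a b.

Definition theory : Type := forall G, fm G -> Prop.

(* [prf T Gam A]: in the theory T, the formula A is derivable from the open
   assumptions Gam; all their free variables are declared in the context G. *)
Inductive prf (T : theory) : forall G, seq (fm G) -> fm G -> Prop :=
| pAx G (Gam : seq (fm G)) A : T G A -> prf T Gam A
| pHyp G (Gam : seq (fm G)) A : List.In A Gam -> prf T Gam A
| pImpI G (Gam : seq (fm G)) A B : prf T (A :: Gam) B -> prf T Gam (A ⊃ B)
| pImpE G (Gam : seq (fm G)) A B :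
    prf T Gam (A ⊃ B) -> prf T Gam A -> prf T Gam B
| pAndI G (Gam : seq (fm G)) A B :
    prf T Gam A -> prf T Gam B -> prf T Gam (A ⩓ B)
| pAndE1 G (Gam : seq (fm G)) A B : prf T Gam (A ⩓ B) -> prf T Gam A
| pAndE2 G (Gam : seq (fm G)) A B : prf T Gam (A ⩓ B) -> prf T Gam B
| pOrI1 G (Gam : seq (fm G)) A B : prf T Gam A -> prf T Gam (A ⩔ B)
| pOrI2 G (Gam : seq (fm G)) A B : prf T Gam B -> prf T Gam (A ⩔ B)
| pOrE G (Gam : seq (fm G)) A B C :
    prf T Gam (A ⩔ B) -> prf T (A :: Gam) C -> prf T (B :: Gam) C ->
    prf T Gam C
| pRAA G (Gam : seq (fm G)) A : prf T ((A ⊃ Bot) :: Gam) Bot -> prf T Gam A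
| pAllI G (Gam : seq (fm G)) t (A : fm (t :: G)) :
    prf T (map (fwk t) Gam) A -> prf T Gam (All t A)
| pAllE G (Gam : seq (fm G)) t (A : fm (t :: G)) a :
    prf T Gam (All t A) -> prf T Gam (inst A a)
| pExI G (Gam : seq (fm G)) t (A : fm (t :: G)) a :
    prf T Gam (inst A a) -> prf T Gam (Ex t A)
| pExE G (Gam : seq (fm G)) t (A : fm (t :: G)) B :
    prf T Gam (Ex t A) -> prf T (A :: map (fwk t) Gam) (fwk t B) ->
    prf T Gam B
| pEqRefl G (Gam : seq (fm G)) a : prf T Gam (a ≐ a)
| pEqSubst G (Gam : seq (fm G)) (A : fm (ty0 :: G)) a b :
    prf T Gam (a ≐ b) -> prf T Gam (inst A a) -> prf T Gam (inst A b).

Definition proves (T : theory) (A : fm [::]) : Prop := prf T [::] A.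

(* QF-AC^{s,t} for A, where in A the variable 0 is y^t and the variable 1 is
   x^s; in the conclusion y is replaced by Y(x). *)
Definition QFAC G s t (A : fm (t :: s :: G)) : fm G :=
  let sg : sub (t :: s :: G) (s :: (s ⇾ t) :: G) :=
    scons (Var (VS V0) ⋅ Var V0)
      (scons (Var V0) (fun u x => Var (VS (VS x)))) in
  All s (Ex t A) ⊃ Ex (s ⇾ t) (All s (fsub sg A)).

Definition succ_inst G (A : fm (ty0 :: G)) : fm (ty0 :: G) :=
  fsub (scons (Var V0 ⊕ One) (fun t x => Var (VS x))) A.

(* The axioms are open formulas, schematic in the terms.  That 0 is the least
   element, discreteness and subtraction are left out: they follow by
   quantifier-free induction. *)
Inductive RCA0w : theory :=
| addA G (x y z : tm G ty0) : RCA0w ((x ⊕ y) ⊕ z ≐ x ⊕ (y ⊕ z))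
| addC G (x y : tm G ty0) : RCA0w (x ⊕ y ≐ y ⊕ x)
| add0 G (x : tm G ty0) : RCA0w (x ⊕ Zero ≐ x)
| mulA G (x y z : tm G ty0) : RCA0w ((x ⊗ y) ⊗ z ≐ x ⊗ (y ⊗ z))
| mulC G (x y : tm G ty0) : RCA0w (x ⊗ y ≐ y ⊗ x)
| mul1 G (x : tm G ty0) : RCA0w (x ⊗ One ≐ x)
| mul0 G (x : tm G ty0) : RCA0w (x ⊗ Zero ≐ Zero)
| mulD G (x y z : tm G ty0) : RCA0w (x ⊗ (y ⊕ z) ≐ x ⊗ y ⊕ x ⊗ z)
| lt_irr G (x : tm G ty0) : RCA0w (x ≺ x ⊃ Bot)
| lt_trans G (x y z : tm G ty0) : RCA0w (x ≺ y ⊃ y ≺ z ⊃ x ≺ z)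
| lt_total G (x y : tm G ty0) : RCA0w (x ≺ y ⩔ x ≐ y ⩔ y ≺ x)
| lt_add G (x y z : tm G ty0) : RCA0w (x ≺ y ⊃ x ⊕ z ≺ y ⊕ z)
| lt_mul G (x y z : tm G ty0) : RCA0w (Zero ≺ z ⊃ x ≺ y ⊃ x ⊗ z ≺ y ⊗ z)
| lt_0_1 G : @RCA0w G (Zero ≺ One)
| Pi_def G s t (x : tm G s) (y : tm G t) : RCA0w (eqT (Pi s t ⋅ x ⋅ y) x)
| Sigma_def G s t u
    (x : tm G (s ⇾ t ⇾ u)) (y : tm G (s ⇾ t)) (z : tm G s) :
    RCA0w (eqT (Sigma s t u ⋅ x ⋅ y ⋅ z) (x ⋅ z ⋅ (y ⋅ z)))
| Rec_0 G (f : tm G ty1) (m : tm G ty0) : RCA0w (Rec ⋅ f ⋅ m ⋅ Zero ≐ m)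
| Rec_S G (f : tm G ty1) (m n : tm G ty0) :
    RCA0w (Rec ⋅ f ⋅ m ⋅ (n ⊕ One) ≐ f ⋅ (Rec ⋅ f ⋅ m ⋅ n))
| ext G s t (phi : tm G (s ⇾ t)) (x y : tm G s) :
    RCA0w (eqT x y ⊃ eqT (phi ⋅ x) (phi ⋅ y))
| qf_ind G (A : fm (ty0 :: G)) : qf A ->
    RCA0w (inst A Zero ⊃ All ty0 (A ⊃ succ_inst A) ⊃ All ty0 A)
| qf_ac G (A : fm (ty0 :: ty1 :: G)) : qf A -> RCA0w (QFAC A).

Definition extend (T : theory) (A : forall G, fm G) : theory :=
  fun G B => T G B \/ B = A G.

(* (mu^2): variables are f (0) and mu (1); under the inner quantifier,
   n (0) and f (1). *)
Definition mu2F G : fm G :=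
  Ex ty2 (All ty1
    (Ex ty0 (Var (VS V0) ⋅ Var V0 ≐ Zero) ⊃
     Var V0 ⋅ (Var (VS V0) ⋅ Var V0) ≐ Zero)).

Definition ACA0w : theory := extend RCA0w mu2F.

Definition prF G (x y : tm G ty0) : tm G ty0 := (x ⊕ y) ⊗ (x ⊕ y) ⊕ y.

(* "c is the code of (g(0), ..., g(n-1))": h lists the codes of the initial
   segments of g, up to length n. *)
Definition initF G (g : tm G ty1) (n c : tm G ty0) : fm G :=
  Ex ty1 (let h := Var V0 in
    h ⋅ Zero ≐ Zero ⩓
    All ty0 (let i := Var V0 in let h := Var (VS V0) in
      i ≺ twk _ (twk _ n) ⊃
      h ⋅ (i ⊕ One) ≐ prF (h ⋅ i) (twk _ (twk _ g) ⋅ i) ⊕ One) ⩓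
    h ⋅ twk _ n ≐ twk _ c).

(* "g is in [(h(0), ..., h(k-1))]" *)
Definition cylF G (h : tm G ty1) (k : tm G ty0) (g : tm G ty1) : fm G :=
  All ty0 (let i := Var V0 in
    i ≺ twk _ k ⊃ twk _ g ⋅ i ≐ twk _ h ⋅ i).

Definition LINF G (Xi : tm G tyLIN) : fm G :=
  All ty2 (All ty1 (Ex ty0
    (let n := Var V0 in
     let g := Var (VS V0) in
     let Psi := Var (VS (VS V0)) in
     let h := twk _ (twk _ (twk _ Xi)) ⋅ Psi ⋅ n in
     cylF h (Psi ⋅ h) g))).

Definition exLINF G : fm G := Ex tyLIN (LINF (Var V0)).

(* f(<g(0), ..., g(n-1)>) = 0 is rendered by "f(c) = 0 for the code c". *)
Definition S2F G : fm G :=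
  Ex ty2 (let Su := Var V0 in
    leT Su (Pi ty0 ty1 ⋅ One) ⩓
    All ty1 (let f := Var V0 in let Su := Var (VS V0) in
      Iff
        (Ex ty1 (All ty0 (Ex ty0
          (let c := Var V0 in
           let n := Var (VS V0) in
           let g := Var (VS (VS V0)) in
           let f := Var (VS (VS (VS V0))) in
           initF g n c ⩓ f ⋅ c ≐ Zero))))
        (Su ⋅ f ≐ Zero))).

(* Main.v *)
Require Import Defs.
From Stdlib Require Import Setoid Morphisms Ring.
From mathcomp Require Import all_boot.

(* The tree of f consists of the finite sequences on which f vanishes.  Map a
   sequence g to Psi(g) = mu(lambda m. 1 - f(g|m)), which is the length of some
   initial segment of g outside the tree as soon as there is one.  Let h_n be
   the centres Xi(Psi)(n) of the countably many neighbourhoods.  If g is a path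
   and lies in the n-th neighbourhood, then f vanishes on h_n|Psi(h_n), since
   this is also an initial segment of g; and this in turn implies by the choice
   of Psi that h_n is itself a path.  Hence there is a path iff
   P(n) = f(h_n|Psi(h_n)) vanishes for some n, iff P(mu(P)) = 0, and
   S(f) = 1 - (1 - P(mu(P))).

   Inside the formal system the recursor only iterates type-1 functions, so the
   codes of initial segments are obtained by iterating on pairs (counter,
   code).  Pairs are decoded by unbounded search with mu, using a
   characteristic function of equality obtained from QF-AC. *)

Set Implicit Arguments.
Unset Strict Implicit.
Unset Printing Implicit Defensive.

Local Open Scope ty_scope.
Local Open Scope Lomega_scope.

(** * Computability by S1-S9 *)

(** The index may depend only on the lengths of the four blocks, not on their contents. [e] expects
    the blocks in the order [A], [B], [C], [D]; the S6 list gives the positions at which they are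
    found when [B] and [C] are exchanged. *)
Definition swap_code (a b c d e : nat) : nat :=
  Defs.code [:: 6, e & iota 0 a ++ iota (a + c) b ++ iota a c ++ iota (a + c + b) d].

Lemma map_nth_infix T (x : T) (s t u : seq T) :
  [seq nth x (s ++ t ++ u) i | i <- iota (size s) (size t)] = t.
Proof.
rewrite map_nth_iota; last by rewrite !size_cat addKn leq_addr.
by rewrite drop_size_cat // take_size_cat.
Qed.

Lemma kleene_swap e (A B C D : seq obj) n : kleene e (A ++ B ++ C ++ D) n ->
  kleene (swap_code (size A) (size B) (size C) (size D) e) (A ++ C ++ B ++ D) n.
Proof.
move=> k; apply: S6.
  rewrite !size_cat !iotaD !add0n perm_cat2l.
  by rewrite perm_catCA.
rewrite !map_cat.
have -> := map_nth_infix (num 0) [::] A (C ++ B ++ D).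
have -> := map_nth_infix (num 0) A C (B ++ D).
have := map_nth_infix (num 0) (A ++ C) B D.
have := map_nth_infix (num 0) (A ++ C ++ B) D [::].
by rewrite !size_cat !addnA cats0 -!catA => -> ->.
Qed.

Fixpoint env (G : seq ty) : Type :=
  match G with [::] => unit | t :: G => (itp t * env G)%type end.

Fixpoint objs G : env G -> seq obj :=
  match G with
  | [::] => fun _ => [::]
  | t :: G => fun r => Obj t r.1 :: objs r.2
  end.

Fixpoint get G t (x : var G t) : env G -> itp t :=
  match x with
  | V0 _ _ => fun r => r.1
  | VS _ _ _ y => fun r => get y r.2
  end.

Fixpoint arity t : nat := match t with ty0 => 0 | _ ⇾ t => (arity t).+1 end.

Lemma size_objs G (r : env G) : size (objs r) = size G.
Proof. by elim: G r => //= t G IH r; rewrite IH. Qed.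

Lemma app_to_inv t (F : itp t) y n : app_to F y n ->
  match t return itp t -> Prop with
  | ty0 => fun F => y = [::] /\ n = F
  | s ⇾ t => fun F => exists x l, y = Obj s x :: l /\ app_to (F x) l n
  end F.
Proof. by case=> // s u {}F x l m aF; exists x, l. Qed.

Lemma size_app_to t (F : itp t) y n : app_to F y n -> size y = arity t.
Proof. by elim=> //= s u _ _ l _ _ ->. Qed.

(** The index is uniform in the environment. A value of higher type is computed through its own
    values, with the arguments [y] in front of the environment, which is the order in which S8 calls
    its indices. *)
Definition computable G t (F : env G -> itp t) : Prop :=
  exists e, forall r y n, app_to (F r) y n -> kleene e (y ++ objs r) n.

Lemma computable_ext G t (F H : env G -> itp t) :
  (forall r, F r = H r) -> computable F -> computable H.
Proof. by move=> eFH [e ke]; exists e => r y n; rewrite -eFH; apply: ke. Qed.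

Lemma computable0 G (F : env G -> itp ty0) :
  computable F <-> exists e, forall r, kleene e (objs r) (F r).
Proof.
split=> -[e ke]; exists e; last first.
  by move=> r y n /app_to_inv /= [-> ->]; apply: ke.
by move=> r; apply/(ke r [::])/app_to0.
Qed.

(** The object to be dropped is swapped to the end of the list, where S9 cuts it off by running [e]
    on the first [m] arguments only; S2 and S4 supply [e] as the leading argument that S9 reads. *)
Lemma computable_weaken G s t (F : env G -> itp t) :
  computable F -> computable (fun r : env (s :: G) => F r.2).
Proof.
case=> e ke; pose m := arity t + size G.
pose w := Defs.code [:: 4; Defs.code [:: 9; m]; Defs.code [:: 2; e]].
exists (swap_code (arity t) (size G) 1 0 w) => r y n aF.
have := @kleene_swap w y (objs r.2) [:: Obj s r.1] [::] n.
rewrite (size_app_to aF) size_objs /= !cats0; apply.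
apply: (S4 (x := e)); first exact: S2.
apply: S9; first by rewrite !size_cat size_objs (size_app_to aF) addnA leq_addr.
rewrite catA take_size_cat; first exact: ke.
by rewrite size_cat size_objs (size_app_to aF).
Qed.

Lemma computable_lam G s t (F : env (s :: G) -> itp t) :
  computable F -> @computable G (s ⇾ t) (fun r x => F (x, r)).
Proof.
case=> e ke; exists (swap_code 0 (arity t) 1 (size G) e).
move=> r y n /app_to_inv [x [l [-> aF]]].
have := @kleene_swap e [::] l [:: Obj s x] (objs r) n.
rewrite (size_app_to aF) size_objs; apply.
exact: (ke (x, r)).
Qed.

Lemma computable_app0 G (F : env G -> itp ty1) (N : env G -> itp ty0) :
  computable F -> computable N -> @computable G ty0 (fun r => F r (N r)).
Proof.
case=> e ke /computable0 [d kd]; apply/computable0.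
exists (Defs.code [:: 4; e; d]) => r; apply: S4 (kd r) _.
by apply: (ke r [:: num (N r)]); apply/app_toS/app_to0.
Qed.

Lemma computable_const G q : @computable G ty0 (fun _ => q).
Proof. by apply/computable0; exists (Defs.code [:: 2; q]) => r; apply: S2. Qed.

Lemma computable_succ G (N : env G -> itp ty0) :
  computable N -> @computable G ty0 (fun r => (N r).+1).
Proof.
move=> cN; apply: (@computable_app0 _ (fun _ => S)) => //.
exists (Defs.code [:: 1]) => r y n /app_to_inv [x [l [-> /app_to_inv [-> ->]]]].
exact: S1.
Qed.

Lemma computable_rec G (A : env G -> itp ty0) (B : env [:: ty0, ty0 & G] -> itp ty0) :
  computable A -> computable B ->
  @computable G ty1 (fun r => nat_rect _ (A r) (fun x c => B (x, (c, r)))).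
Proof.
move=> /computable0 [d kd] /computable0 [e ke]; exists (Defs.code [:: 5; d; e]).
move=> r y n /app_to_inv [x [l [-> /app_to_inv [-> ->]]]] /=.
elim: x => [|x IHx]; first exact: S5_0.
exact: S5_S IHx (ke (x, (_, r))).
Qed.

Fixpoint args (G : seq ty) (t : ty) : Type :=
  match t with
  | ty0 => unit
  | s ⇾ t => ((env G -> itp s) * args G t)%type
  end.

Fixpoint apply_args G (r : env G) t : itp t -> args G t -> nat :=
  match t with
  | ty0 => fun F _ => F
  | s ⇾ t => fun F a => apply_args r (F (a.1 r)) a.2
  end.

Fixpoint args_objs G (r : env G) t : args G t -> seq obj :=
  match t with
  | ty0 => fun _ => [::]
  | s ⇾ t => fun a => Obj s (a.1 r) :: args_objs r a.2
  end.

Fixpoint computable_args G t : args G t -> Prop :=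
  match t with
  | ty0 => fun _ => True
  | s ⇾ t => fun a => computable a.1 /\ computable_args a.2
  end.

Lemma app_to_args G (r : env G) t (F : itp t) (a : args G t) :
  app_to F (args_objs r a) (apply_args r F a).
Proof.
elim: t F a => [F a|s _ t IHt F a] /=; first exact: app_to0.
exact/app_toS/IHt.
Qed.

Lemma objs_get G t (x : var G t) : exists i j, forall r : env G, exists L M,
  [/\ objs r = L ++ Obj t (get x r) :: M, size L = i & size M = j].
Proof.
elim: x => {G t} [G t|G t u x [i [j IH]]].
  by exists 0, (size G) => r; exists [::], (objs r.2); rewrite size_objs.
exists i.+1, j => r; have [L [M [e <- <-]]] := IH r.2.
by exists (Obj u r.1 :: L), M; rewrite /= e.
Qed.

(** S8 is what passes arguments of higher type to an object, and it wants that object at the head of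
    the list. So the object named by [x] is swapped to the front, and the index of each argument is
    composed with the swap back. *)
Lemma computable_var_app G t (x : var G t) (a : args G t) :
  computable_args a -> @computable G ty0 (fun r => apply_args r (get x r) a).
Proof.
move=> ca; apply/computable0; have [i [j split_objs]] := objs_get x.
(* The indices are collected by induction on [t]. The splitting of the environment is quantified
   here, because [x] has type [t] and cannot be kept during the induction. *)
have [ds dsP] : exists ds, forall r, size ds = size (args_objs r a) /\
    forall k, k < size (args_objs r a) -> forall y m,
      app_to (projT2 (nth (num 0) (args_objs r a) k)) y m ->
      forall L F M, objs r = L ++ F :: M -> size L = i -> size M = j ->
      kleene (nth 0 ds k) (y ++ F :: L ++ M) m.
  elim: {x split_objs} t a ca => [|s _ t IHt] a /=; first by exists [::].
  case=> -[e ke] /IHt [ds dsP]; exists (swap_code (arity s) i 1 j e :: ds) => r.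
  have [eds {}dsP] := dsP r; split; first by rewrite /= eds.
  case=> [_ y m|k]; last exact: dsP.
  move=> aF L F M eL <- <-; have := @kleene_swap e y L [:: F] M m.
  rewrite -(size_app_to aF); apply.
  by have := ke _ _ _ aF; rewrite eL.
exists (swap_code 0 1 i j (Defs.code (8 :: ds))) => r.
have [L [M [e sL sM]]] := split_objs r; have [eds {}dsP] := dsP r.
rewrite e; have := @kleene_swap (Defs.code (8 :: ds)) [::] [:: Obj t (get x r)] L M.
rewrite sL sM; apply; apply: S8 eds _ (app_to_args _ _ _) => k lt_k y m aF.
exact: (dsP k lt_k y m aF).
Qed.

Lemma computable_get1 G (x : var G ty1) : computable (get x).
Proof.
have c : @computable (ty0 :: G) ty0 (fun r => get x r.2 r.1).
  apply: (@computable_var_app _ ty1 (VS x) (fun r => r.1, tt)); split=> //.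
  apply/computable0; exists (Defs.code [:: 3]) => r; exact: S3.
exact: computable_lam c.
Qed.

(** A number is an object without arguments, and S8 with an empty list of indices returns it. *)
Lemma computable_get0 G (x : var G ty0) : computable (get x).
Proof. exact: (@computable_var_app _ ty0 x tt). Qed.

Section Arithmetic.
Variables (G : seq ty) (A B : env G -> itp ty0).
Hypotheses (cA : computable A) (cB : computable B).

Lemma computable_add : @computable G ty0 (fun r => A r + B r).
Proof.
have cS : computable (fun r : env [:: ty0, ty0 & G] => (get (VS V0) r).+1 : itp ty0).
  exact/computable_succ/computable_get0.
apply: computable_ext (computable_app0 (computable_rec cA cS) cB) => r /=.
by elim: (B r) => [|n /= ->]; rewrite ?addn0 ?addnS.
Qed.

Lemma computable_om : @computable G ty0 (fun r => 1 - A r).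
Proof.
have c1 := @computable_const G 1; have c0 := @computable_const [:: ty0, ty0 & G] 0.
apply: computable_ext (computable_app0 (computable_rec c1 c0) cA) => r /=.
by case: (A r).
Qed.
End Arithmetic.

Lemma computable_mul G (A B : env G -> itp ty0) :
  computable A -> computable B -> @computable G ty0 (fun r => A r * B r).
Proof.
move=> cA cB; have c0 := @computable_const G 0.
have cS : computable
    (fun r : env [:: ty0, ty0 & G] => A r.2.2 + get (VS V0) r : itp ty0).
  apply: computable_add; last exact: computable_get0.
  exact: (computable_weaken ty0 (computable_weaken ty0 cA)).
apply: computable_ext (computable_app0 (computable_rec c0 cS) cB) => r /=.
by elim: (B r) => [|n /= ->]; rewrite ?muln0 ?mulnS.
Qed.

(** S5 passes the counter to the step, so the code is built by direct recursion on the length. *)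
Lemma computable_initseg G (g : env G -> itp ty1) (N : env G -> itp ty0) :
  computable g -> computable N ->
  @computable G ty0 (fun r => Defs.code (initseg (g r) (N r))).
Proof.
move=> cg cN; have c0 := @computable_const G 0.
have cS : @computable [:: ty0, ty0 & G] ty0
    (fun r => (pr (get (VS V0) r) (g r.2.2 (get V0 r))).+1).
  apply: computable_succ; rewrite /pr.
  have cx := computable_get0 (VS V0 : var [:: ty0, ty0 & G] ty0).
  have cy := computable_app0
    (computable_weaken ty0 (computable_weaken ty0 cg)) (computable_get0 V0).
  by apply/computable_add/cy/computable_mul; apply: computable_add.
apply: computable_ext (computable_app0 (computable_rec c0 cS) cN) => r /=.
elim: (N r) => // n IHn; rewrite /initseg /Defs.code mkseqS foldl_rcons.
by rewrite -/(Defs.code _) -/(initseg _ _) -IHn.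
Qed.

(** * The Suslin functional over the full type structure *)

Definition leaf_arg (f : itp ty1) (mu : itp ty2) (g : itp ty1) : nat :=
  mu (fun m => 1 - f (Defs.code (initseg g m))).

Definition cover_end f mu (Xi : itp tyLIN) (n : nat) : nat :=
  let h := Xi (leaf_arg f mu) n in f (Defs.code (initseg h (leaf_arg f mu h))).

(** In the notation of the introduction, [leaf_arg f mu] is Psi, [cover_end f mu Xi] is P and
    [Suslin_of f mu Xi] is S(f). *)
Definition Suslin_of f mu Xi : nat :=
  1 - (1 - cover_end f mu Xi (mu (cover_end f mu Xi))).

Lemma computable_leaf_arg G (f : var G ty1) (mu : var G ty2) (g : env G -> itp ty1) :
  computable g -> @computable G ty0 (fun r => leaf_arg (get f r) (get mu r) (g r)).
Proof.
move=> cg; apply: (@computable_var_app _ ty2 mu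
  (fun r m => 1 - get f r (Defs.code (initseg (g r) m)), tt)); split=> //.
apply: (@computable_lam _ _ ty0 (fun r : env (ty0 :: G) =>
  1 - get (VS f) r (Defs.code (initseg (g r.2) (get V0 r))))).
apply/computable_om/computable_app0; first exact: computable_get1.
by apply: computable_initseg; [apply: computable_weaken | apply: computable_get0].
Qed.

Lemma computable_cover_end G (f : var G ty1) (mu : var G ty2) (Xi : var G tyLIN)
    (N : env G -> itp ty0) : computable N ->
  @computable G ty0 (fun r => cover_end (get f r) (get mu r) (get Xi r) (N r)).
Proof.
move=> cN.
have ch : @computable G ty1 (fun r => get Xi r (leaf_arg (get f r) (get mu r)) (N r)).
  apply: (@computable_lam _ _ ty0 (fun r : env (ty0 :: G) =>
    get (VS Xi) r (leaf_arg (get (VS f) r) (get (VS mu) r)) (N r.2) (get V0 r))).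
  apply: (@computable_var_app _ tyLIN (VS Xi)
    (fun r => leaf_arg (get (VS f) r) (get (VS mu) r), (fun r => N r.2, (get V0, tt)))).
  split; last by split; [apply: computable_weaken | split=> //; apply: computable_get0].
  apply: (@computable_lam _ _ ty0 (fun r : env [:: ty1, ty0 & G] =>
    leaf_arg (get (VS (VS f)) r) (get (VS (VS mu)) r) (get V0 r))).
  exact/computable_leaf_arg/computable_get1.
apply: computable_app0; first exact: computable_get1.
by apply: computable_initseg => //; apply: computable_leaf_arg.
Qed.

Lemma computable_Suslin : exists e, forall f mu Xi,
  kleene e [:: Obj ty1 f; Obj ty2 mu; Obj tyLIN Xi] (Suslin_of f mu Xi).
Proof.
pose G := [:: ty1; ty2; tyLIN]; pose f : var G ty1 := V0.
pose mu : var G ty2 := VS V0; pose Xi : var G tyLIN := VS (VS V0).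
suff /computable0 [e ke] : @computable G ty0
    (fun r => Suslin_of (get f r) (get mu r) (get Xi r)).
  by exists e => f0 mu0 Xi0; apply: (ke (f0, (mu0, (Xi0, tt)))).
do 2!apply: computable_om; apply: computable_cover_end.
apply: (@computable_var_app _ ty2 mu
  (fun r => cover_end (get f r) (get mu r) (get Xi r), tt)); split=> //.
apply: (@computable_lam _ _ ty0 (fun r : env (ty0 :: G) =>
  cover_end (get (VS f) r) (get (VS mu) r) (get (VS Xi) r) (get V0 r))).
exact/computable_cover_end/computable_get0.
Qed.

Lemma Suslin_ofE mu Xi Su f : is_mu mu -> LIN Xi -> is_Suslin Su ->
  Suslin_of f mu Xi = Su f.
Proof.
move=> muP XiP [le1 SuP].
pose h n := Xi (leaf_arg f mu) n.
have path_end n : cover_end f mu Xi n = 0 ->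
    forall m, f (Defs.code (initseg (h n) m)) = 0.
  (* If [f] were nonzero on some segment of [h n], then [mu] would find such a segment, whereas by
     [e] the function [f] vanishes on the one that [mu] finds. *)
  move=> e m; apply/eqP/contraT; rewrite -lt0n => pos.
  have := muP (fun m => 1 - f (Defs.code (initseg (h n) m))).
  rewrite -/(leaf_arg f mu (h n)) => mu0.
  have {mu0} :
      1 - f (Defs.code (initseg (h n) (leaf_arg f mu (h n)))) = 0.
    by apply: mu0; exists m; case: (f _) pos.
  by move: e; rewrite /cover_end => ->.
have SuE : Su f = 0 <-> exists n, cover_end f mu Xi n = 0.
  rewrite -SuP; split=> [[g gP]|[n /path_end hP]]; last by exists (h n).
  (* The path [g] agrees with the centre [h n] up to the length Psi([h n]), so P(n) is a value of
     [f] along [g]. *)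
  have [n cyl] := XiP (leaf_arg f mu) g; exists n.
  rewrite -[RHS](gP (leaf_arg f mu (h n))) /cover_end -/(h n); congr (f (Defs.code _)).
  rewrite /initseg /mkseq; apply/eq_in_map => i; rewrite mem_iota /= => lt_i.
  move: cyl => /(_ i); rewrite size_mkseq => -> //.
  by rewrite nth_mkseq.
rewrite /Suslin_of; case eP: (cover_end _ _ _ _) => [|k].
  by symmetry; apply/SuE; exists (mu (cover_end f mu Xi)).
(* Now P(mu(P)) is nonzero and the computed value is 1. Were [Su f] zero, P would have a zero and
   [mu] would have found one. *)
case: (Su f) (le1 f) SuE => [|[|//]] _ // [/(_ erefl) /muP]; by rewrite eP.
Qed.

(** * Substitution, derivability and lambda abstraction *)

Lemma var_consP u G (P : forall t, var (u :: G) t -> Prop) :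
  P u V0 -> (forall t y, P t (VS y)) -> forall t x, P t x.
Proof.
move=> P0 PS t x.
(* A motive over all contexts, trivial on the empty one, so that case analysis on [x] needs no
   equation between contexts. *)
pose Q L t : var L t -> Prop :=
  match L return var L t -> Prop with
  | [::] => fun _ => True
  | v :: D => fun x => forall P : (forall t, var (v :: D) t -> Prop),
      P v V0 -> (forall t y, P t (VS y)) -> P t x
  end.
have Qx : Q _ _ x by case: x => /=; auto.
exact: (Qx P P0 PS).
Qed.

Definition ids G : sub G G := fun t x => Var x.
Arguments ids {G} t _.

Lemma tsub_tsub G D K (sg : sub G D) (tau : sub D K) t (a : tm G t) :
  tsub tau (tsub sg a) = tsub (fun t x => tsub tau (sg t x)) a.
Proof. by elim: a => //= s u a -> b ->. Qed.

Lemma tsub_id G t (a : tm G t) : tsub ids a = a.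
Proof. by elim: a => //= s u a -> b ->. Qed.

(** On a shifted variable [scons b sg] computes to [sg], so the two substitutions are convertible
    and no extensionality is called for. *)
Lemma tsub_scons_twk G D u (b : tm D u) (sg : sub G D) t (a : tm G t) :
  tsub (scons b sg) (twk u a) = tsub sg a.
Proof. by rewrite /twk tsub_tsub. Qed.

Lemma tsub_up_twk G D u (sg : sub G D) t (a : tm G t) :
  tsub (up sg) (twk u a) = twk u (tsub sg a).
Proof. by rewrite /twk !tsub_tsub. Qed.

Lemma twk_tsub G D u (sg : sub G D) t (a : tm G t) :
  tsub (fun t x => twk u (sg t x)) a = twk u (tsub sg a).
Proof. by rewrite /twk tsub_tsub. Qed.

Lemma tsub_shift G u t (a : tm G t) : tsub (fun t x => Var (VS x)) a = twk u a.
Proof. by []. Qed.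

Lemma tsub_Var G t (a : tm G t) : tsub (fun t x => Var x) a = a.
Proof. exact: tsub_id. Qed.

Definition tsubE :=
  (tsub_scons_twk, tsub_up_twk, tsub_id, tsub_Var, tsub_shift).

(* Bracket abstraction.  [inl] marks the terms without the abstracted variable:
   abstracting these to [Pi ⋅ a] at once makes [lam] commute with
   substitution on the nose. *)
Definition abs_var u G t (x : var (u :: G) t) : tm G t + tm G (u ⇾ t) :=
  match x in var L t return
    match L with [::] => unit | u :: G => (tm G t + tm G (u ⇾ t))%type end
  with
  | V0 _ u => inr (Sigma u (u ⇾ u) u ⋅ Pi u (u ⇾ u) ⋅ Pi u u)
  | VS _ t u y => inl (Var y)
  end.

Definition abs_fun u G t (c : tm G t + tm G (u ⇾ t)) : tm G (u ⇾ t) :=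
  match c with inl a => Pi t u ⋅ a | inr f => f end.

Fixpoint abs u G t (a : tm (u :: G) t) : tm G t + tm G (u ⇾ t) :=
  match a with
  | Var _ x => abs_var x
  | App _ _ a b =>
      match abs a, abs b with
      | inl a, inl b => inl (a ⋅ b)
      | f, g => inr (Sigma _ _ _ ⋅ abs_fun f ⋅ abs_fun g)
      end
  | Zero => inl Zero
  | One => inl One
  | Plus => inl Plus
  | Times => inl Times
  | Pi s t => inl (Pi s t)
  | Sigma s t u => inl (Sigma s t u)
  | Rec => inl Rec
  end.

Definition lam u G t (a : tm (u :: G) t) : tm G (u ⇾ t) := abs_fun (abs a).

Lemma abs_twk u G t (a : tm G t) : abs (twk u a) = inl a.
Proof. by rewrite /twk; elim: a => //= s v a -> b ->. Qed.

Lemma tsub_lam G D (sg : sub G D) u t (a : tm (u :: G) t) :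
  tsub sg (lam a) = lam (tsub (up sg) a).
Proof.
rewrite /lam; suff ->: abs (tsub (up sg) a) =
  match abs a with inl b => inl (tsub sg b) | inr f => inr (tsub sg f) end.
  by case: (abs a).
elim: a => //= [v x|s v a -> b ->].
  by elim/var_consP: v / x => //= v y; apply: abs_twk.
by case: (abs a) => ?; case: (abs b).
Qed.

Lemma fsub_eqT t G D (sg : sub G D) (a b : tm G t) :
  fsub sg (eqT a b) = eqT (tsub sg a) (tsub sg b).
Proof.
rewrite /eqT; elim: t G D sg a b => //= s _ u IHu G D sg a b.
by rewrite IHu /= !tsubE.
Qed.

(** * Derivability in the extended theory and provable equality *)

Local Notation theoryLIN := (extend ACA0w exLINF).
Local Notation "Gam ⊢ A" := (prf theoryLIN Gam A) (at level 95, no associativity).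

Lemma prf_weaken G (Gam Del : seq (fm G)) A :
  (forall B, List.In B Gam -> List.In B Del) -> Gam ⊢ A -> Del ⊢ A.
Proof.
have cons2 K (C : fm K) (l m : seq (fm K)) : (forall B, List.In B l -> List.In B m) ->
  forall B, List.In B (C :: l) -> List.In B (C :: m).
  by move=> sub B /= [|/sub]; auto.
have map2 K t (l m : seq (fm K)) : (forall B, List.In B l -> List.In B m) ->
  forall B, List.In B (map (fwk t) l) -> List.In B (map (fwk t) m).
  by move=> sub B /List.in_map_iff [C [<- /sub ?]]; apply/List.in_map.
move=> sub prA; elim: prA Del sub => {G Gam A}.
- by move=> *; apply: pAx.
- by move=> G Gam A inA Del sub; apply/pHyp/sub.
- by move=> G Gam A B _ IH Del sub; apply/pImpI/IH/cons2.
- by move=> G Gam A B _ IH1 _ IH2 Del sub; apply: pImpE (IH1 _ _) (IH2 _ _).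
- by move=> G Gam A B _ IH1 _ IH2 Del sub; apply: pAndI (IH1 _ _) (IH2 _ _).
- by move=> G Gam A B _ IH Del sub; apply: pAndE1 (IH _ _).
- by move=> G Gam A B _ IH Del sub; apply: pAndE2 (IH _ _).
- by move=> G Gam A B _ IH Del sub; apply/pOrI1/IH.
- by move=> G Gam A B _ IH Del sub; apply/pOrI2/IH.
- move=> G Gam A B C _ IH1 _ IH2 _ IH3 Del sub.
  by apply: pOrE (IH1 _ sub) (IH2 _ _) (IH3 _ _); apply: cons2.
- by move=> G Gam A _ IH Del sub; apply/pRAA/IH/cons2.
- by move=> G Gam t A _ IH Del sub; apply/pAllI/IH/map2.
- by move=> G Gam t A a _ IH Del sub; apply/pAllE/IH.
- by move=> G Gam t A a _ IH Del sub; apply/pExI/IH.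
- move=> G Gam t A B _ IH1 _ IH2 Del sub.
  by apply: pExE (IH1 _ sub) (IH2 _ _); apply/cons2/map2.
- by move=> *; apply: pEqRefl.
- by move=> G Gam A a b _ IH1 _ IH2 Del sub; apply: pEqSubst (IH1 _ sub) (IH2 _ sub).
Qed.

Lemma prf_cons G (Gam : seq (fm G)) A B : Gam ⊢ B -> A :: Gam ⊢ B.
Proof. by apply: prf_weaken => C /=; right. Qed.

Lemma prf_hd G (Gam : seq (fm G)) A : A :: Gam ⊢ A.
Proof. by apply: pHyp; left. Qed.
#[local] Hint Resolve prf_hd prf_cons : core.

Lemma prf_ax G (Gam : seq (fm G)) A : RCA0w A -> Gam ⊢ A.
Proof. by move=> axA; apply: pAx; left; left. Qed.

Lemma prf_cut G (Gam : seq (fm G)) A B : Gam ⊢ A -> A :: Gam ⊢ B -> Gam ⊢ B.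
Proof. by move=> pA /pImpI pB; apply: pImpE pB pA. Qed.

Lemma prf_exfalso G (Gam : seq (fm G)) A : Gam ⊢ Bot -> Gam ⊢ A.
Proof. by move=> p; apply/pRAA/prf_cons. Qed.

Lemma prf_EM G (Gam : seq (fm G)) A : Gam ⊢ A ⩔ (A ⊃ Bot).
Proof.
apply: pRAA; apply: (@pImpE _ _ _ (A ⩔ (A ⊃ Bot))) => //.
apply/pOrI2/pImpI; apply: (@pImpE _ _ _ (A ⩔ (A ⊃ Bot))); auto.
by apply: pOrI1.
Qed.

Section ExtensionalEquality.
Variables (G : seq ty) (Gam : seq (fm G)).

Definition eqv t (a b : tm G t) : Prop := Gam ⊢ eqT a b.

Lemma eqv_arr s t (f g : tm G (s ⇾ t)) (a : tm G s) :
  eqv f g -> eqv (f ⋅ a) (g ⋅ a).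
Proof.
move/(@pAllE _ _ _ _ _ a).
by rewrite /inst -/(eqT _ _) fsub_eqT /= !tsubE.
Qed.

End ExtensionalEquality.

Lemma eqT_refl t G (Gam : seq (fm G)) (a : tm G t) : Gam ⊢ eqT a a.
Proof.
elim: t G Gam a => [|s _ t IHt] G Gam a; first exact: pEqRefl.
by apply: pAllI; apply: (IHt _ _ (twk s a ⋅ Var V0)).
Qed.

Lemma eqT_app_fwk s t G (Gam : seq (fm (s :: G))) (f g : tm G (s ⇾ t)) :
  Gam ⊢ fwk s (eqT f g) ->
  Gam ⊢ eqT (twk s f ⋅ Var V0) (twk s g ⋅ Var V0).
Proof. by rewrite /fwk fsub_eqT; apply: eqv_arr. Qed.

(** The implication is kept inside the calculus, for every context and every [Gam], so that the
    induction on the type can pass below the quantifier of pointwise equality. The same holds for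
    transitivity. *)
Lemma eqT_imp_sym t G (Gam : seq (fm G)) (a b : tm G t) :
  Gam ⊢ eqT a b ⊃ eqT b a.
Proof.
elim: t G Gam a b => [|s _ t IHt] G Gam a b.
  apply: pImpI.
  have := @pEqSubst theoryLIN _ ((a ≐ b) :: Gam)
    (Var V0 ≐ twk _ a) a b (prf_hd _ _).
  by rewrite /inst /= !tsubE; apply; apply: pEqRefl.
apply/pImpI/pAllI; apply: pImpE (IHt _ _ (twk s a ⋅ Var V0) (twk s b ⋅ Var V0)) _.
exact/eqT_app_fwk/prf_hd.
Qed.

Lemma eqT_imp_trans t G (Gam : seq (fm G)) (a b c : tm G t) :
  Gam ⊢ eqT a b ⊃ eqT b c ⊃ eqT a c.
Proof.
elim: t G Gam a b c => [|s _ t IHt] G Gam a b c.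
  apply/pImpI/pImpI.
  have := @pEqSubst theoryLIN _ ((b ≐ c) :: (a ≐ b) :: Gam)
    (twk _ a ≐ Var V0) b c (prf_hd _ _).
  by rewrite /inst /= !tsubE; apply; auto.
apply/pImpI/pImpI/pAllI.
apply: pImpE (pImpE (IHt _ _
  (twk s a ⋅ Var V0) (twk s b ⋅ Var V0) (twk s c ⋅ Var V0)) _) _.
  by apply/eqT_app_fwk/prf_cons/prf_hd.
exact/eqT_app_fwk/prf_hd.
Qed.

Lemma eqv_Eq G (Gam : seq (fm G)) (a b : tm G ty0) : eqv Gam a b -> Gam ⊢ a ≐ b.
Proof. by []. Qed.

#[export] Instance eqv_equivalence G (Gam : seq (fm G)) t :
  Equivalence (@eqv G Gam t).
Proof.
split.
- by move=> a; apply: eqT_refl.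
- by move=> a b; apply/pImpE/eqT_imp_sym.
- by move=> a b c p; apply/pImpE/(pImpE _ p)/eqT_imp_trans.
Qed.

(** In the function position, instantiating the pointwise equality is enough; the argument position
    rests on the axiom of extensionality. *)
#[export] Instance App_proper G (Gam : seq (fm G)) s t :
  Proper (@eqv G Gam (s ⇾ t) ==> @eqv G Gam s ==> @eqv G Gam t) (@App G s t).
Proof.
move=> f g efg a b eab; transitivity (f ⋅ b); last exact: eqv_arr.
exact: pImpE (prf_ax _ (ext f a b)) eab.
Qed.

Lemma inst_eqv G (Gam : seq (fm G)) (A : fm (ty0 :: G)) a b :
  eqv Gam a b -> Gam ⊢ inst A a -> Gam ⊢ inst A b.
Proof. exact: pEqSubst. Qed.

(** Meant for terms such as [unpairL], whose argument is buried under abstractions: one substitutes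
    in the equation t(a) = t(z), which is reflexivity at z = a. *)
Lemma tsub_eqv G (Gam : seq (fm G)) (t : tm (ty0 :: G) ty0) a b :
  eqv Gam a b -> eqv Gam (tsub (scons a ids) t) (tsub (scons b ids) t).
Proof.
move=> eab; have := @inst_eqv _ Gam (twk _ (tsub (scons a ids) t) ≐ t) a b eab.
by rewrite /inst /= !tsubE; apply; apply: pEqRefl.
Qed.

Lemma prf_Eq_congr G (Gam : seq (fm G)) a a' b b' :
  eqv Gam a a' -> eqv Gam b b' -> Gam ⊢ a ≐ b -> Gam ⊢ a' ≐ b'.
Proof.
move=> ea eb eab; change (eqv Gam a' b'); transitivity a; first by symmetry.
by transitivity b.
Qed.

Lemma prf_Lt_congr G (Gam : seq (fm G)) a a' b b' :
  eqv Gam a a' -> eqv Gam b b' -> Gam ⊢ a ≺ b -> Gam ⊢ a' ≺ b'.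
Proof.
move=> ea eb lab.
have := @inst_eqv _ Gam (Var V0 ≺ twk _ b) a a' ea.
rewrite /inst /= !tsubE => /(_ lab) lab'.
have := @inst_eqv _ Gam (twk _ a' ≺ Var V0) b b' eb.
by rewrite /inst /= !tsubE; apply.
Qed.

Lemma lam_beta G (Gam : seq (fm G)) u t (a : tm (u :: G) t) (b : tm G u) :
  eqv Gam (lam a ⋅ b) (tsub (scons b ids) a).
Proof.
have PiE s v (c : tm G s) (d : tm G v) : eqv Gam (Pi s v ⋅ c ⋅ d) c.
  exact/prf_ax/Pi_def.
have SigmaE s v (f : tm G (u ⇾ s ⇾ v)) (g : tm G (u ⇾ s)) :
  eqv Gam (Sigma _ _ _ ⋅ f ⋅ g ⋅ b) (f ⋅ b ⋅ (g ⋅ b)) by apply/prf_ax/Sigma_def.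
rewrite /lam; elim: a => //= [v x|s v a IHa c IHc].
  elim/var_consP: v / x => [|v y] /=; last exact: PiE.
  by rewrite SigmaE PiE; reflexivity.
rewrite -IHa -IHc; case: (abs a) => f; case: (abs c) => g /=;
  rewrite ?SigmaE ?PiE //.
all: reflexivity.
Qed.
#[local] Hint Extern 0 (eqv _ _ _) => reflexivity : core.

(** * Arithmetic *)

Lemma prf_ind G (Gam : seq (fm G)) (A : fm (ty0 :: G)) n :
  qf A -> Gam ⊢ inst A Zero -> A :: map (fwk ty0) Gam ⊢ succ_inst A ->
  Gam ⊢ inst A n.
Proof.
move=> qA A0 /pImpI /pAllI AS; apply: pAllE.
exact: pImpE (pImpE (prf_ax _ (qf_ind qA)) A0) AS.
Qed.

Section Arithmetic.
Variables (G : seq ty) (Gam : seq (fm G)).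
Implicit Types x y z w : tm G ty0.

(** [ring] works with binary operations, while [⊕] and [⊗] are notations for two applications of a
    constant; these aliases are what it is shown. *)
Definition addT x y := x ⊕ y.
Definition mulT x y := x ⊗ y.

Lemma add0T x : eqv Gam (Zero ⊕ x) x.
Proof.
transitivity (x ⊕ Zero); first exact/prf_ax/addC.
exact/prf_ax/add0.
Qed.

Lemma tm_semi_ring :
  semi_ring_theory (Zero : tm G ty0) One addT mulT (@eqv G Gam ty0).
Proof.
have mulCT x y : eqv Gam (x ⊗ y) (y ⊗ x) by apply/prf_ax/mulC.
split; rewrite /addT /mulT.
- exact: add0T.
- by move=> x y; apply/prf_ax/addC.
- by move=> x y z; symmetry; apply/prf_ax/addA.
- by move=> x; rewrite mulCT; apply/prf_ax/mul1.
- by move=> x; rewrite mulCT; apply/prf_ax/mul0.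
- exact: mulCT.
- by move=> x y z; symmetry; apply/prf_ax/mulA.
- move=> x y z; rewrite mulCT (mulCT x) (mulCT y).
  exact/prf_ax/mulD.
Qed.

#[local] Instance addT_proper :
  Proper (@eqv G Gam ty0 ==> @eqv G Gam ty0 ==> @eqv G Gam ty0) addT.
Proof. by rewrite /addT => a a' ea b b' eb; rewrite ea eb. Qed.

#[local] Instance mulT_proper :
  Proper (@eqv G Gam ty0 ==> @eqv G Gam ty0 ==> @eqv G Gam ty0) mulT.
Proof. by rewrite /mulT => a a' ea b b' eb; rewrite ea eb. Qed.

Lemma tm_sring_eq_ext : sring_eq_ext addT mulT (@eqv G Gam ty0).
Proof. split; [exact: addT_proper | exact: mulT_proper]. Qed.

Add Ring tm_ring : tm_semi_ring
  (setoid (eqv_equivalence Gam ty0) tm_sring_eq_ext).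

(** If x' + y' = (x + y) + (w + 1), the code of (x', y') exceeds that of (x, y) by exactly one more
    than this term. *)
Definition prF_excess x y w y' : tm G ty0 :=
  (x ⊕ y) ⊗ w ⊕ x ⊕ (x ⊕ y) ⊗ (w ⊕ One) ⊕ (w ⊕ One) ⊗ w ⊕ w ⊕ y'.

Lemma prF_expand x y w y' :
  eqv Gam (((x ⊕ y) ⊕ (w ⊕ One)) ⊗ ((x ⊕ y) ⊕ (w ⊕ One)) ⊕ y')
    ((prF_excess x y w y' ⊕ One) ⊕ prF x y).
Proof.
rewrite /prF_excess /prF -!/(addT _ _) -!/(mulT _ _); ring.
Qed.

Lemma addTC x y : eqv Gam (x ⊕ y) (y ⊕ x).
Proof. exact/prf_ax/addC. Qed.

Lemma addTA x y z : eqv Gam (x ⊕ y ⊕ z) (x ⊕ (y ⊕ z)).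
Proof. exact/prf_ax/addA. Qed.

Lemma lt_absurd x C : Gam ⊢ x ≺ x -> Gam ⊢ C.
Proof. by move=> lxx; apply/prf_exfalso/(pImpE (prf_ax _ (lt_irr x))). Qed.

Lemma ltT_trans y x z : Gam ⊢ x ≺ y -> Gam ⊢ y ≺ z -> Gam ⊢ x ≺ z.
Proof. by move=> lxy; apply/pImpE/(pImpE _ lxy)/prf_ax/lt_trans. Qed.

Lemma lt_add2r z x y : Gam ⊢ x ≺ y -> Gam ⊢ x ⊕ z ≺ y ⊕ z.
Proof. exact/pImpE/prf_ax/lt_add. Qed.

Lemma lt_succ x : Gam ⊢ x ≺ x ⊕ One.
Proof.
apply: prf_Lt_congr (lt_add2r x (prf_ax _ (lt_0_1 G))); first exact: add0T.
exact: addTC.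
Qed.

Lemma lt_cases x y C :
  (x ≺ y) :: Gam ⊢ C -> (x ≐ y) :: Gam ⊢ C -> (y ≺ x) :: Gam ⊢ C -> Gam ⊢ C.
Proof.
move=> pl pe pg; apply: pOrE (prf_ax _ (lt_total x y)) _ _ => //.
apply: pOrE (prf_hd _ _) _ _; apply: prf_weaken; last first.
- exact: pg.
- by move=> B /=; intuition.
- exact: pe.
- by move=> B /=; intuition.
Qed.

End Arithmetic.

Lemma lt0_succ G (Gam : seq (fm G)) x : Gam ⊢ Zero ≺ x ⊕ One.
Proof.
have := @prf_ind _ Gam (Zero ≺ Var V0 ⊕ One) x isT.
rewrite /inst /succ_inst /=; apply.
  apply: prf_Lt_congr (prf_ax _ (lt_0_1 G)) => //.
  by symmetry; apply: add0T.
by apply: ltT_trans (lt_succ _ _).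
Qed.

Section MoreArithmetic.
Variables (G : seq ty) (Gam : seq (fm G)).
Implicit Types x y z w : tm G ty0.

Lemma add_succ_neq z x C : eqv Gam x ((z ⊕ One) ⊕ x) -> Gam ⊢ C.
Proof.
move=> e; apply: (@lt_absurd _ _ x); have := lt_add2r x (lt0_succ Gam z).
apply: prf_Lt_congr; first exact: add0T.
by symmetry.
Qed.

(** Truncated subtraction 1 - x: the first application of the constant function 0 turns the start
    value 1 into 0. *)
Definition om x : tm G ty0 := Rec ⋅ (Pi ty0 ty0 ⋅ Zero) ⋅ One ⋅ x.

Lemma om0 x : eqv Gam x Zero -> eqv Gam (om x) One.
Proof. by rewrite /om => ->; apply/prf_ax/Rec_0. Qed.

Lemma omS x : eqv Gam (om (x ⊕ One)) Zero.
Proof.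
transitivity (Pi ty0 ty0 ⋅ Zero ⋅ om x); first exact/prf_ax/Rec_S.
exact/prf_ax/Pi_def.
Qed.

Lemma one_neq0 C : eqv Gam One Zero -> Gam ⊢ C.
Proof.
move=> e; apply: (@add_succ_neq Zero Zero).
transitivity (@Zero G ⊕ One); last by symmetry; apply: prf_ax; apply: add0.
by rewrite add0T; symmetry.
Qed.

End MoreArithmetic.

Lemma om_cases G (Gam : seq (fm G)) x : Gam ⊢ x ≐ Zero ⩔ om x ≐ Zero.
Proof.
have := @prf_ind _ Gam (Var V0 ≐ Zero ⩔ om (Var V0) ≐ Zero) x isT.
rewrite /inst /succ_inst /=; apply; first exact/pOrI1/pEqRefl.
exact/pOrI2/omS.
Qed.

Lemma om_le1 G (Gam : seq (fm G)) x : Gam ⊢ le0 (om x) One.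
Proof.
apply: pOrE (om_cases Gam x) _ _.
  exact/pOrI2/om0/prf_hd.
apply/pOrI1/(prf_Lt_congr _ _ (prf_ax _ (lt_0_1 G))) => //.
by symmetry; apply: prf_hd.
Qed.

(** * Search with mu *)

Definition muF G (mu : tm G ty2) : fm G :=
  All ty1 (Ex ty0 (Var (VS V0) ⋅ Var V0 ≐ Zero) ⊃
    Var V0 ⋅ (twk _ mu ⋅ Var V0) ≐ Zero).

(** [Y] decides x(0) = x(1) for a function x. Two numbers to be compared are packed into one type-1
    object, because choice is available only from type 1 to type 0. *)
Definition eqcharF G (Y : tm G ty2) : fm G :=
  All ty1 (let x := Var V0 in
    (x ⋅ Zero ≐ x ⋅ One ⩓ twk _ Y ⋅ x ≐ Zero) ⩔
    ((x ⋅ Zero ≐ x ⋅ One ⊃ Bot) ⩓ twk _ Y ⋅ x ≐ One)).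

Lemma eqcharF_ex G (Gam : seq (fm G)) : Gam ⊢ Ex ty2 (eqcharF (Var V0)).
Proof.
pose x : tm (ty0 :: ty1 :: G) ty1 := Var (VS V0).
pose A := (x ⋅ Zero ≐ x ⋅ One ⩓ Var V0 ≐ Zero) ⩔
  ((x ⋅ Zero ≐ x ⋅ One ⊃ Bot) ⩓ Var V0 ≐ One).
have /(prf_ax Gam) ac : RCA0w (QFAC A) by apply: qf_ac.
apply: pImpE ac _; apply: pAllI.
apply: pOrE (prf_EM _ (Var V0 ⋅ Zero ≐ Var V0 ⋅ One)) _ _.
  apply: (@pExI _ _ _ _ _ Zero); rewrite /inst /=.
  by apply/pOrI1/pAndI => //; apply: pEqRefl.
apply: (@pExI _ _ _ _ _ One); rewrite /inst /=.
by apply/pOrI2/pAndI => //; apply: pEqRefl.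
Qed.

(** [mu] and [Y] will be the variables of eliminated existential statements, so their properties are
    open assumptions that have to be carried under binders. *)
Definition oracles G (Gam : seq (fm G)) (mu Y : tm G ty2) : Prop :=
  List.In (muF mu) Gam /\ List.In (eqcharF Y) Gam.

Lemma oracles_cons G (Gam : seq (fm G)) mu Y A :
  oracles Gam mu Y -> oracles (A :: Gam) mu Y.
Proof. by case; split; right. Qed.

Lemma oracles_fwk G (Gam : seq (fm G)) mu Y t :
  oracles Gam mu Y -> oracles (map (fwk t) Gam) (twk t mu) (twk t Y).
Proof.
have emu : fwk t (muF mu) = muF (twk t mu) by rewrite /fwk /muF /= !tsubE.
have eY : fwk t (eqcharF Y) = eqcharF (twk t Y) by rewrite /fwk /eqcharF /= !tsubE.
by case=> /(List.in_map (fwk t)) + /(List.in_map (fwk t)); rewrite emu eY.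
Qed.
#[local] Hint Resolve oracles_cons oracles_fwk : core.

Lemma mu_zero G (Gam : seq (fm G)) mu Y f n : oracles Gam mu Y ->
  eqv Gam (f ⋅ n) Zero -> eqv Gam (f ⋅ (mu ⋅ f)) Zero.
Proof.
case=> /(@pHyp theoryLIN) inmu _ fn.
have := @pAllE _ _ _ _ _ f inmu.
rewrite /inst /= !tsubE => /pImpE; apply.
by apply: (@pExI _ _ _ _ _ n); rewrite /inst /= !tsubE.
Qed.

(* A solution n of a(n) = b(n), and a junk value if there is none. *)
Definition sol G (mu Y : tm G ty2) (a b : tm (ty0 :: G) ty0) : tm G ty0 :=
  mu ⋅ lam (twk _ Y ⋅ (Rec ⋅ (Pi ty0 ty0 ⋅ b) ⋅ a)).


Lemma tsub_sol G D (sg : sub G D) mu Y a b :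
  tsub sg (sol mu Y a b) =
    sol (tsub sg mu) (tsub sg Y) (tsub (up sg) a) (tsub (up sg) b).
Proof. by rewrite /sol /= tsub_lam /= !tsubE. Qed.

Lemma solP G (Gam : seq (fm G)) mu Y (a b : tm (ty0 :: G) ty0) n :
  oracles Gam mu Y ->
  eqv Gam (tsub (scons n ids) a) (tsub (scons n ids) b) ->
  eqv Gam (tsub (scons (sol mu Y a b) ids) a)
    (tsub (scons (sol mu Y a b) ids) b).
Proof.
move=> orc; have [_ /(@pHyp theoryLIN) inY] := orc.
(* Iterating the constant function b(m) from a(m) gives a function with value a(m) at 0 and b(m) at
   1, which is the input that [Y] compares. *)
pose pair m : tm G ty1 :=
  Rec ⋅ (Pi ty0 ty0 ⋅ tsub (scons m ids) b) ⋅ tsub (scons m ids) a.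
have pair0 m : eqv Gam (pair m ⋅ Zero) (tsub (scons m ids) a).
  exact/prf_ax/Rec_0.
have pair1 m : eqv Gam (pair m ⋅ One) (tsub (scons m ids) b).
  transitivity (pair m ⋅ (Zero ⊕ One)); first by rewrite add0T.
  transitivity (Pi ty0 ty0 ⋅ tsub (scons m ids) b ⋅ (pair m ⋅ Zero)).
    exact/prf_ax/Rec_S.
  exact/prf_ax/Pi_def.
have Ypair m : Gam ⊢ (pair m ⋅ Zero ≐ pair m ⋅ One ⩓ Y ⋅ pair m ≐ Zero) ⩔
    ((pair m ⋅ Zero ≐ pair m ⋅ One ⊃ Bot) ⩓ Y ⋅ pair m ≐ One).
  have := @pAllE _ _ _ _ _ (pair m) inY.
  by rewrite /inst /= !tsubE.
pose f := lam (twk _ Y ⋅ (Rec ⋅ (Pi ty0 ty0 ⋅ b) ⋅ a)).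
have fE m : eqv Gam (f ⋅ m) (Y ⋅ pair m) by rewrite /f lam_beta /= !tsubE; reflexivity.
move=> e; have : eqv Gam (f ⋅ sol mu Y a b) Zero.
  apply: (mu_zero orc (n := n)); rewrite fE.
  apply: pOrE (Ypair n) _ _; first exact/pAndE2/prf_hd.
  apply/prf_exfalso/pImpE; first exact/pAndE1/prf_hd.
  by apply/prf_cons/eqv_Eq; rewrite pair0 pair1.
rewrite fE => f0; rewrite -pair0 -pair1.
apply: pOrE (Ypair (sol mu Y a b)) _ _; first exact/pAndE1/prf_hd.
apply: one_neq0; transitivity (Y ⋅ pair (sol mu Y a b)); last exact: prf_cons.
symmetry; exact/pAndE2/prf_hd.
Qed.

#[local] Opaque sol.

Section Decoding.
Variables (G : seq ty) (mu Y : tm G ty2).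
Implicit Types (x y s : tm G ty0).

Definition pred_tm x := sol mu Y (Var V0 ⊕ One) (twk _ x).
Definition sub_tm y x := sol mu Y (twk _ x ⊕ Var V0) (twk _ y).
Definition unpair2 s x := sol mu Y (prF (twk _ x) (Var V0)) (twk _ s).
End Decoding.

(** Two nested searches: for each x the inner one proposes a second component, and the outer one
    looks for an x whose proposal is correct. *)
Definition unpairL G (mu Y : tm G ty2) s : tm G ty0 :=
  sol mu Y (prF (Var V0) (unpair2 (twk _ mu) (twk _ Y) (twk _ s) (Var V0)))
    (twk _ s).

Definition unpairR G (mu Y : tm G ty2) s : tm G ty0 :=
  unpair2 mu Y s (unpairL mu Y s).


Section DecodingSub.
Variables (G D : seq ty) (sg : sub G D) (mu Y : tm G ty2).

Lemma tsub_pred_tm x :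
  tsub sg (pred_tm mu Y x) = pred_tm (tsub sg mu) (tsub sg Y) (tsub sg x).
Proof. by rewrite /pred_tm tsub_sol /= !tsubE. Qed.

Lemma tsub_sub_tm x y :
  tsub sg (sub_tm mu Y y x) = sub_tm (tsub sg mu) (tsub sg Y) (tsub sg y) (tsub sg x).
Proof. by rewrite /sub_tm tsub_sol /= !tsubE. Qed.

Lemma tsub_unpair2 s x : tsub sg (unpair2 mu Y s x) =
  unpair2 (tsub sg mu) (tsub sg Y) (tsub sg s) (tsub sg x).
Proof. by rewrite /unpair2 tsub_sol /= !tsubE. Qed.
End DecodingSub.

Lemma tsub_unpairL G D (sg : sub G D) mu Y s :
  tsub sg (unpairL mu Y s) = unpairL (tsub sg mu) (tsub sg Y) (tsub sg s).
Proof. rewrite /unpairL tsub_sol /=; by rewrite tsub_unpair2 !tsubE. Qed.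

Lemma tsub_unpairR G D (sg : sub G D) mu Y s :
  tsub sg (unpairR mu Y s) = unpairR (tsub sg mu) (tsub sg Y) (tsub sg s).
Proof. by rewrite /unpairR tsub_unpair2 tsub_unpairL. Qed.

Lemma pred_cases G (Gam : seq (fm G)) mu Y x : oracles Gam mu Y ->
  Gam ⊢ x ≐ Zero ⩔ pred_tm mu Y x ⊕ One ≐ x.
Proof.
move=> orc.
pose A : fm (ty0 :: G) := Var V0 ≐ Zero ⩔
  pred_tm (twk _ mu) (twk _ Y) (Var V0) ⊕ One ≐ Var V0.
have := @prf_ind _ Gam A x isT; rewrite /inst /succ_inst /=.
rewrite !tsub_pred_tm !tsubE /=; apply; first exact/pOrI1/pEqRefl.
apply: pOrI2.
have := @solP _ (A :: map (fwk ty0) Gam) (twk _ mu) (twk _ Y)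
  (Var V0 ⊕ One) (twk _ (Var V0 ⊕ One)) (Var V0).
by rewrite !tsubE /=; apply; auto.
Qed.

(** * Codes of initial segments *)

(** Induction on x, quantifier-free because the difference is a term. If x + d = y, then d = 0 gives
    y < x + 1, and d = p + 1 makes p a solution for x + 1. *)
Lemma sub_cases G (Gam : seq (fm G)) mu Y x y : oracles Gam mu Y ->
  Gam ⊢ y ≺ x ⩔ x ⊕ sub_tm mu Y y x ≐ y.
Proof.
move=> orc.
pose A : fm (ty0 :: G) := twk _ y ≺ Var V0 ⩔
  Var V0 ⊕ sub_tm (twk _ mu) (twk _ Y) (twk _ y) (Var V0) ≐ twk _ y.
have subE D (Del : seq (fm D)) nu Z a b n : oracles Del nu Z ->
    eqv Del (a ⊕ n) b -> eqv Del (a ⊕ sub_tm nu Z b a) b.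
  move=> orcD e; have := @solP _ Del nu Z (twk _ a ⊕ Var V0) (twk _ b) n orcD.
  by rewrite /= !tsubE; apply.
have := @prf_ind _ Gam A x isT.
rewrite /inst /succ_inst /= !tsub_sub_tm !tsubE /=; apply.
  by apply/pOrI2/(subE _ _ _ _ _ _ y); [| exact: add0T].
have orc' : oracles (A :: map (fwk ty0) Gam) (twk _ mu) (twk _ Y) by auto.
apply: pOrE (prf_hd _ _) _ _.
  exact/pOrI1/(ltT_trans (prf_hd _ _))/lt_succ.
set d := sub_tm _ _ _ _; set B := _ ≐ _.
have eB Del : eqv (B :: Del) (Var V0 ⊕ d) (twk _ y) by apply: prf_hd.
apply: pOrE (pred_cases d (oracles_cons B orc')) _ _.
  apply: pOrI1; apply: prf_Lt_congr (lt_succ _ (Var V0)) => //.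
  transitivity (Var (@V0 G ty0) ⊕ d); last exact/prf_cons/eB.
  transitivity (Var (@V0 G ty0) ⊕ Zero); first by symmetry; apply/prf_ax/add0.
  by apply: App_proper => //; symmetry; apply: prf_hd.
apply/pOrI2/(subE _ _ _ _ _ _ (pred_tm (twk _ mu) (twk _ Y) d)).
  by do 2!apply: oracles_cons.
transitivity (Var (@V0 G ty0) ⊕ d); last exact/prf_cons/eB.
set p := pred_tm _ _ _.
transitivity (Var (@V0 G ty0) ⊕ (One ⊕ p)); first exact: addTA.
apply: App_proper => //; transitivity (p ⊕ One); first exact: addTC.
exact: prf_hd.
Qed.

Lemma lt_diff G (Gam : seq (fm G)) mu Y x y : oracles Gam mu Y ->
  Gam ⊢ x ≺ y -> eqv Gam (x ⊕ (pred_tm mu Y (sub_tm mu Y y x) ⊕ One)) y.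
Proof.
move=> orc lxy.
apply: pOrE (sub_cases x y orc) _ _.
  by apply: lt_absurd (ltT_trans (prf_cons _ lxy) (prf_hd _ _)).
set d := sub_tm _ _ _ _; set B := _ ≐ _.
have eB Del : eqv (B :: Del) (x ⊕ d) y by apply: prf_hd.
apply: pOrE (pred_cases d (oracles_cons B orc)) _ _.
  apply: (@lt_absurd _ _ x); apply: prf_Lt_congr (prf_cons _ (prf_cons _ lxy)) => //.
  symmetry; transitivity (x ⊕ Zero); first by symmetry; apply/prf_ax/add0.
  transitivity (x ⊕ d); last exact/prf_cons/eB.
  by apply: App_proper => //; symmetry; apply: prf_hd.
apply: eqv_Eq; transitivity (x ⊕ d); last exact/prf_cons/eB.
by apply: App_proper => //; apply: prf_hd.
Qed.

#[export] Instance prF_proper G (Gam : seq (fm G)) :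
  Proper (@eqv G Gam ty0 ==> @eqv G Gam ty0 ==> @eqv G Gam ty0) (@prF G).
Proof. by rewrite /prF => a a' ea b b' eb; rewrite ea eb. Qed.

(** With the sums differing by d + 1, [prF_expand] makes the second code a successor plus the first,
    so the codes cannot be equal. *)
Lemma prF_lt G (Gam : seq (fm G)) mu Y x y x' y' C : oracles Gam mu Y ->
  eqv Gam (prF x y) (prF x' y') -> Gam ⊢ x ⊕ y ≺ x' ⊕ y' -> Gam ⊢ C.
Proof.
move=> orc epr /(lt_diff orc); set d := pred_tm _ _ _ => ed.
apply: (@add_succ_neq _ _ (prF_excess x y d y') (prF x y)).
by rewrite -prF_expand ed.
Qed.

Lemma add_cancel G (Gam : seq (fm G)) x y z :
  eqv Gam (x ⊕ z) (y ⊕ z) -> eqv Gam x y.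
Proof.
move=> e.
have lt_neq a b C Del : eqv Del (a ⊕ z) (b ⊕ z) -> (a ≺ b) :: Del ⊢ C.
  move=> eab; apply: (@lt_absurd _ _ (b ⊕ z)).
  by apply: prf_Lt_congr (lt_add2r z (prf_hd _ _)) => //; apply: prf_cons.
apply: (@lt_cases _ _ x y); first exact: lt_neq.
- exact: prf_hd.
- by apply: lt_neq; symmetry.
Qed.

(** By trichotomy and [prF_lt] the sums agree; then the squares cancel, which gives y = y', and
    cancelling y gives x = x'. *)
Lemma prF_inj G (Gam : seq (fm G)) mu Y x y x' y' : oracles Gam mu Y ->
  eqv Gam (prF x y) (prF x' y') -> eqv Gam x x' /\ eqv Gam y y'.
Proof.
move=> orc e.
have es : eqv Gam (x ⊕ y) (x' ⊕ y').
  apply: (@lt_cases _ _ (x ⊕ y) (x' ⊕ y')); last 1 first.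
  - apply: prF_lt (oracles_cons _ orc) _ (prf_hd _ _).
    by apply/prf_cons/eqv_Eq; symmetry; exact: e.
  - by apply: prF_lt (oracles_cons _ orc) _ (prf_hd _ _); apply: prf_cons; exact: e.
  - exact: prf_hd.
have ey : eqv Gam y y'.
  apply: (@add_cancel _ _ _ _ ((x' ⊕ y') ⊗ (x' ⊕ y'))).
  rewrite addTC (addTC _ y') -[X in eqv _ _ X]/(prF x' y') -e /prF es; reflexivity.
by split=> //; apply: (@add_cancel _ _ _ _ y); rewrite es ey.
Qed.

Section Unpairing.
Variables (G : seq ty) (Gam : seq (fm G)) (mu Y : tm G ty2).
Hypothesis orc : oracles Gam mu Y.

(** The components found by search are only known to form a pair with the given code, which x and y
    show to be possible; injectivity identifies them. *)
Lemma unpair_prF x y :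
  eqv Gam (unpairL mu Y (prF x y)) x /\ eqv Gam (unpairR mu Y (prF x y)) y.
Proof.
apply: prF_inj (orc) _.
have := @solP _ Gam mu Y (prF (twk _ x) (Var V0)) (twk _ (prF x y)) y orc.
rewrite /= !tsubE => /(_ (eqT_refl _ _)) e1.
have := @solP _ Gam mu Y (prF (Var V0) (unpair2 (twk _ mu) (twk _ Y)
  (twk _ (prF x y)) (Var V0))) (twk _ (prF x y)) x orc.
by rewrite /= !tsub_unpair2 /= !tsubE; apply.
Qed.

#[export] Instance unpairL_proper :
  Proper (@eqv G Gam ty0 ==> @eqv G Gam ty0) (unpairL mu Y).
Proof.
move=> a b /(tsub_eqv (unpairL (twk _ mu) (twk _ Y) (Var V0))).
by rewrite !tsub_unpairL !tsubE.
Qed.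

#[export] Instance unpairR_proper :
  Proper (@eqv G Gam ty0 ==> @eqv G Gam ty0) (unpairR mu Y).
Proof.
move=> a b /(tsub_eqv (unpairR (twk _ mu) (twk _ Y) (Var V0))).
by rewrite !tsub_unpairR !tsubE.
Qed.
End Unpairing.
#[local] Opaque unpairL unpairR.

(* The recursor iterates a function that does not see the counter, so the
   state holds both the counter and the code of the initial segment. *)
Definition seg_step G (mu Y : tm G ty2) (g : tm G ty1) : tm G ty1 :=
  let s := Var V0 in
  let L := unpairL (twk _ mu) (twk _ Y) s in
  let R := unpairR (twk _ mu) (twk _ Y) s in
  lam (prF (L ⊕ One) (prF R (twk _ g ⋅ L) ⊕ One)).

Definition seg_state G (mu Y : tm G ty2) (g : tm G ty1) (i : tm G ty0) : tm G ty0 :=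
  Rec ⋅ seg_step mu Y g ⋅ prF Zero Zero ⋅ i.

Definition seg G (mu Y : tm G ty2) (g : tm G ty1) (i : tm G ty0) : tm G ty0 :=
  unpairR mu Y (seg_state mu Y g i).

Lemma tsub_seg_state G D (sg : sub G D) mu Y g i : tsub sg (seg_state mu Y g i) =
  seg_state (tsub sg mu) (tsub sg Y) (tsub sg g) (tsub sg i).
Proof.
by rewrite /seg_state /seg_step /= tsub_lam /= !tsub_unpairL !tsub_unpairR !tsubE.
Qed.

Lemma tsub_seg G D (sg : sub G D) mu Y g i : tsub sg (seg mu Y g i) =
  seg (tsub sg mu) (tsub sg Y) (tsub sg g) (tsub sg i).
Proof. by rewrite /seg tsub_unpairR tsub_seg_state. Qed.

Section Segments.
Variables (G : seq ty) (Gam : seq (fm G)) (mu Y : tm G ty2).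
Hypothesis orc : oracles Gam mu Y.

#[export] Instance seg_proper g :
  Proper (@eqv G Gam ty0 ==> @eqv G Gam ty0) (seg mu Y g).
Proof. by move=> i j eij; rewrite /seg /seg_state eij. Qed.

Lemma seg_stateS g i (s := seg_state mu Y g i) :
  eqv Gam (seg_state mu Y g (i ⊕ One))
    (prF (unpairL mu Y s ⊕ One)
      (prF (unpairR mu Y s) (g ⋅ unpairL mu Y s) ⊕ One)).
Proof.
transitivity (seg_step mu Y g ⋅ s); first exact/prf_ax/Rec_S.
by rewrite /seg_step lam_beta /= !tsub_unpairL !tsub_unpairR !tsubE; reflexivity.
Qed.

Lemma seg_state0 g : eqv Gam (seg_state mu Y g Zero) (prF Zero Zero).
Proof. exact/prf_ax/Rec_0. Qed.

Lemma seg0 g : eqv Gam (seg mu Y g Zero) Zero.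
Proof. rewrite /seg seg_state0; exact: (unpair_prF orc _ _).2. Qed.
End Segments.

(** The step applies g to the counter stored in the state, and [segS] needs this to be i. *)
Lemma seg_counter G (Gam : seq (fm G)) mu Y g i : oracles Gam mu Y ->
  eqv Gam (unpairL mu Y (seg_state mu Y g i)) i.
Proof.
move=> orc.
pose A := unpairL (twk _ mu) (twk _ Y)
  (seg_state (twk _ mu) (twk _ Y) (twk _ g) (Var V0)) ≐ Var V0.
have := @prf_ind _ Gam A i isT; rewrite /inst /succ_inst /=.
rewrite !tsub_unpairL !tsub_seg_state !tsubE /=; apply.
  change (eqv Gam (unpairL mu Y (seg_state mu Y g Zero)) Zero).
  rewrite seg_state0; exact: (unpair_prF orc _ _).1.
pose Del := A :: map (fwk ty0) Gam.
have orc' : oracles Del (twk _ mu) (twk _ Y).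
  exact/oracles_cons/oracles_fwk.
change (eqv Del (unpairL (twk _ mu) (twk _ Y)
  (seg_state (twk _ mu) (twk _ Y) (twk _ g) (Var V0 ⊕ One))) (Var V0 ⊕ One)).
rewrite seg_stateS (unpair_prF orc' _ _).1.
apply: App_proper => //; apply: App_proper => //; exact: prf_hd.
Qed.

Lemma segS G (Gam : seq (fm G)) mu Y g i : oracles Gam mu Y ->
  eqv Gam (seg mu Y g (i ⊕ One)) (prF (seg mu Y g i) (g ⋅ i) ⊕ One).
Proof.
move=> orc; rewrite {1}/seg seg_stateS (unpair_prF orc _ _).2.
by rewrite seg_counter.
Qed.
#[local] Opaque seg.

(** * The Suslin functional as a term *)

Definition stepsF G (k g : tm G ty1) (n : tm G ty0) : fm G :=
  All ty0 (let i := Var V0 in i ≺ twk _ n ⊃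
    twk _ k ⋅ (i ⊕ One) ≐ prF (twk _ k ⋅ i) (twk _ g ⋅ i) ⊕ One).

Lemma fsub_stepsF G D (sg : sub G D) k g n :
  fsub sg (stepsF k g n) = stepsF (tsub sg k) (tsub sg g) (tsub sg n).
Proof. by rewrite /stepsF /= !tsubE. Qed.

Lemma stepsFE G (Gam : seq (fm G)) k g n i : Gam ⊢ stepsF k g n ->
  Gam ⊢ i ≺ n -> eqv Gam (k ⋅ (i ⊕ One)) (prF (k ⋅ i) (g ⋅ i) ⊕ One).
Proof.
move=> /(@pAllE _ _ _ _ _ i); rewrite /inst /= !tsubE => /pImpE; exact.
Qed.

Lemma seg_unique G (Gam : seq (fm G)) mu Y k g n : oracles Gam mu Y ->
  eqv Gam (k ⋅ Zero) Zero -> Gam ⊢ stepsF k g n ->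
  eqv Gam (k ⋅ n) (seg mu Y g n).
Proof.
(* The recurrence becomes an open assumption, so that it is still at hand, shifted, below the
   quantifier of the induction. *)
move=> orc k0 steps; apply: prf_cut steps _.
(* The recurrence holds only below n. The bound is put into the induction formula as a disjunct,
   which keeps it quantifier-free, and at n itself this disjunct is absurd. *)
pose A := twk _ n ≺ Var V0 ⩔
  twk _ k ⋅ Var V0 ≐ seg (twk _ mu) (twk _ Y) (twk _ g) (Var V0).
suff: stepsF k g n :: Gam ⊢ inst A n.
  rewrite /inst /= !tsub_seg !tsubE /= => /pOrE; apply; last exact: prf_hd.
  exact/lt_absurd/prf_hd.
apply: prf_ind => //.
  rewrite /inst /= !tsub_seg !tsubE /=; apply/pOrI2/eqv_Eq.
  rewrite seg0; [exact: prf_cons | exact: oracles_cons].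
rewrite /succ_inst /= !tsub_seg !tsubE /=; set Del := A :: _.
have orc' : oracles Del (twk _ mu) (twk _ Y).
  by do 2!apply: oracles_cons; apply: oracles_fwk.
have steps B : B :: Del ⊢ stepsF (twk _ k) (twk _ g) (twk _ n).
  by do 2!apply: prf_cons; rewrite -fsub_stepsF; apply: prf_hd.
apply: pOrE (prf_hd _ _) _ _.
  exact/pOrI1/(ltT_trans (prf_hd _ _))/lt_succ.
set E := _ ≐ _.
apply: (@lt_cases _ _ (Var V0) (twk _ n)).
- apply/pOrI2/eqv_Eq; set L := _ ≺ _.
  rewrite (stepsFE (prf_cons L (steps E)) (prf_hd _ _)) segS;
    last by do 2!apply: oracles_cons.
  apply: App_proper => //; apply: App_proper => //; apply: prF_proper => //.
  exact/prf_cons/prf_hd.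
- apply: pOrI1; apply: prf_Lt_congr (lt_succ _ (Var V0)) => //; exact: prf_hd.
- exact/pOrI1/(ltT_trans (prf_hd _ _))/lt_succ.
Qed.

Definition seg_fun G (mu Y : tm G ty2) (g : tm G ty1) : tm G ty1 :=
  lam (seg (twk _ mu) (twk _ Y) (twk _ g) (Var V0)).

Lemma tsub_seg_fun G D (sg : sub G D) mu Y g :
  tsub sg (seg_fun mu Y g) = seg_fun (tsub sg mu) (tsub sg Y) (tsub sg g).
Proof. by rewrite /seg_fun tsub_lam tsub_seg !tsubE. Qed.

Lemma seg_funE G (Gam : seq (fm G)) mu Y g i :
  eqv Gam (seg_fun mu Y g ⋅ i) (seg mu Y g i).
Proof. by rewrite lam_beta tsub_seg !tsubE; reflexivity. Qed.
#[local] Opaque seg_fun.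

Lemma initF_seg G (Gam : seq (fm G)) mu Y g n : oracles Gam mu Y ->
  Gam ⊢ initF g n (seg mu Y g n).
Proof.
move=> orc; apply: (@pExI _ _ _ _ _ (seg_fun mu Y g)).
rewrite /inst /= !tsubE; apply: pAndI; last apply: pAndI.
- by apply: eqv_Eq; rewrite seg_funE; apply: seg0.
- apply/pAllI/pImpI/eqv_Eq; rewrite /twk !tsub_seg_fun -!/(twk _ _).
  rewrite !seg_funE; apply: segS.
  exact/oracles_cons/oracles_fwk.
- exact: seg_funE.
Qed.

Lemma initF_inv G (Gam : seq (fm G)) mu Y g n c : oracles Gam mu Y ->
  Gam ⊢ initF g n c -> eqv Gam c (seg mu Y g n).
Proof.
move=> orc /pExE; apply; rewrite /fwk /= tsub_seg -!/(twk _ _).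
pose B := Var V0 ⋅ Zero ≐ Zero ⩓ stepsF (Var V0) (twk _ g) (twk _ n) ⩓
  Var V0 ⋅ twk _ n ≐ twk _ c.
pose Del := B :: map (fwk ty1) Gam.
have orc' : oracles Del (twk _ mu) (twk _ Y) by apply/oracles_cons/oracles_fwk.
have hyp : Del ⊢ B by apply: prf_hd.
change (eqv Del (twk _ c) (seg (twk _ mu) (twk _ Y) (twk _ g) (twk _ n))).
rewrite -(seg_unique orc' (pAndE1 hyp) (pAndE1 (pAndE2 hyp))).
by symmetry; apply: pAndE2 (pAndE2 hyp).
Qed.

(* Psi, h_n and P(n) of the introduction are [leaf_search], [candidate] and
   [cover_val]. *)
Definition leaf_test G mu Y (f g : tm G ty1) : tm G ty1 :=
  lam (om (twk _ f ⋅ seg (twk _ mu) (twk _ Y) (twk _ g) (Var V0))).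

Lemma tsub_leaf_test G D (sg : sub G D) mu Y f g :
  tsub sg (leaf_test mu Y f g) =
  leaf_test (tsub sg mu) (tsub sg Y) (tsub sg f) (tsub sg g).
Proof. by rewrite /leaf_test tsub_lam /= tsub_seg !tsubE. Qed.

Lemma leaf_testE G (Gam : seq (fm G)) mu Y f g n :
  eqv Gam (leaf_test mu Y f g ⋅ n) (om (f ⋅ seg mu Y g n)).
Proof. by rewrite lam_beta /= tsub_seg !tsubE; reflexivity. Qed.
#[local] Opaque leaf_test.

Definition leaf_search G mu Y (f : tm G ty1) : tm G ty2 :=
  lam (twk _ mu ⋅ leaf_test (twk _ mu) (twk _ Y) (twk _ f) (Var V0)).

Lemma tsub_leaf_search G D (sg : sub G D) mu Y f :
  tsub sg (leaf_search mu Y f) =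
  leaf_search (tsub sg mu) (tsub sg Y) (tsub sg f).
Proof. by rewrite /leaf_search tsub_lam /= tsub_leaf_test !tsubE. Qed.

Lemma leaf_searchE G (Gam : seq (fm G)) mu Y f g :
  eqv Gam (leaf_search mu Y f ⋅ g) (mu ⋅ leaf_test mu Y f g).
Proof. by rewrite lam_beta /= tsub_leaf_test !tsubE; reflexivity. Qed.
#[local] Opaque leaf_search.

Definition candidate G mu Y (Xi : tm G tyLIN) f (n : tm G ty0) : tm G ty1 :=
  Xi ⋅ leaf_search mu Y f ⋅ n.

Definition cover_val G mu Y (Xi : tm G tyLIN) f (n : tm G ty0) : tm G ty0 :=
  let h := candidate mu Y Xi f n in f ⋅ seg mu Y h (leaf_search mu Y f ⋅ h).

Lemma tsub_cover_val G D (sg : sub G D) mu Y Xi f n :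
  tsub sg (cover_val mu Y Xi f n) =
  cover_val (tsub sg mu) (tsub sg Y) (tsub sg Xi) (tsub sg f) (tsub sg n).
Proof. by rewrite /cover_val /candidate /= tsub_seg /= !tsub_leaf_search. Qed.

Definition cover_fun G mu Y (Xi : tm G tyLIN) (f : tm G ty1) : tm G ty1 :=
  lam (cover_val (twk _ mu) (twk _ Y) (twk _ Xi) (twk _ f) (Var V0)).

Lemma tsub_cover_fun G D (sg : sub G D) mu Y Xi f :
  tsub sg (cover_fun mu Y Xi f) =
  cover_fun (tsub sg mu) (tsub sg Y) (tsub sg Xi) (tsub sg f).
Proof. by rewrite /cover_fun tsub_lam tsub_cover_val !tsubE. Qed.

Lemma cover_funE G (Gam : seq (fm G)) mu Y Xi f n :
  eqv Gam (cover_fun mu Y Xi f ⋅ n) (cover_val mu Y Xi f n).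
Proof. by rewrite lam_beta tsub_cover_val !tsubE; reflexivity. Qed.
#[local] Opaque cover_fun.

Definition Suslin_val G mu Y (Xi : tm G tyLIN) f : tm G ty0 :=
  om (om (cover_fun mu Y Xi f ⋅ (mu ⋅ cover_fun mu Y Xi f))).

Definition Suslin_tm G mu Y (Xi : tm G tyLIN) : tm G ty2 :=
  lam (Suslin_val (twk _ mu) (twk _ Y) (twk _ Xi) (Var V0)).

Lemma tsub_Suslin_tm G D (sg : sub G D) mu Y Xi :
  tsub sg (Suslin_tm mu Y Xi) =
  Suslin_tm (tsub sg mu) (tsub sg Y) (tsub sg Xi).
Proof. by rewrite /Suslin_tm tsub_lam /= !tsub_cover_fun !tsubE. Qed.

Lemma Suslin_tmE G (Gam : seq (fm G)) mu Y Xi f :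
  eqv Gam (Suslin_tm mu Y Xi ⋅ f) (Suslin_val mu Y Xi f).
Proof. by rewrite lam_beta /= !tsub_cover_fun !tsubE; reflexivity. Qed.
#[local] Opaque Suslin_tm.

Lemma om_om0 G (Gam : seq (fm G)) x : eqv Gam x Zero -> eqv Gam (om (om x)) Zero.
Proof.
move=> /om0 x0; have {1}-> : eqv Gam (om (om x)) (om (Zero ⊕ One)).
  by rewrite /om; apply: App_proper => //; rewrite add0T; apply: x0.
exact: omS.
Qed.

Lemma om_eq0 G (Gam : seq (fm G)) x C :
  eqv Gam x Zero -> eqv Gam (om x) Zero -> Gam ⊢ C.
Proof.
move=> /om0 x1 e; apply: one_neq0; transitivity (om x); last exact: e.
by symmetry.
Qed.

(** The path condition in the very form that it has inside [S2F], so that the final equivalence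
    matches by conversion. *)
Definition branchF G (f g : tm G ty1) : fm G :=
  All ty0 (Ex ty0 (initF (twk _ (twk _ g)) (Var (VS V0)) (Var V0) ⩓
    twk _ (twk _ f) ⋅ Var V0 ≐ Zero)).

Lemma branchFE G (Gam : seq (fm G)) mu Y f g n : oracles Gam mu Y ->
  Gam ⊢ branchF f g -> eqv Gam (f ⋅ seg mu Y g n) Zero.
Proof.
move=> orc /(@pAllE _ _ _ _ _ n); rewrite /inst /= !tsubE.
move=> /pExE; apply; rewrite /fwk /= tsub_seg -!/(twk _ _).
pose B := initF (twk _ g) (twk _ n) (Var V0) ⩓ twk _ f ⋅ Var V0 ≐ Zero.
pose Del := B :: map (fwk ty0) Gam.
have orc' : oracles Del (twk _ mu) (twk _ Y) by apply/oracles_cons/oracles_fwk.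
change (Del ⊢ twk _ f ⋅ seg (twk _ mu) (twk _ Y) (twk _ g) (twk _ n) ≐ Zero).
have hyp : Del ⊢ B by apply: prf_hd.
apply: eqv_Eq; rewrite -(initF_inv orc' (pAndE1 hyp)).
exact: pAndE2 hyp.
Qed.

(** Below k the values of g and h agree, so the codes of the segments of g obey the recurrence for
    h, and [seg_unique] applies. *)
Lemma cylF_seg G (Gam : seq (fm G)) mu Y h k g : oracles Gam mu Y ->
  Gam ⊢ cylF h k g -> eqv Gam (seg mu Y h k) (seg mu Y g k).
Proof.
move=> orc cyl; rewrite -[X in eqv _ _ X](seg_funE Gam); symmetry.
apply: seg_unique => //; first by rewrite seg_funE seg0.
apply: prf_cut cyl _; apply/pAllI/pImpI/eqv_Eq.
rewrite /twk !tsub_seg_fun -!/(twk _ _).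
pose Del : seq (fm (ty0 :: G)) :=
  (Var V0 ≺ twk _ k) :: fwk ty0 (cylF h k g) :: map (fwk ty0) Gam.
have orc' : oracles Del (twk _ mu) (twk _ Y).
  by do 2!apply: oracles_cons; apply: oracles_fwk.
have eqgh : eqv Del (twk _ g ⋅ Var V0) (twk _ h ⋅ Var V0).
  have := @pAllE _ _ Del _ _ (Var V0) (prf_cons _ (prf_hd _ _)).
  rewrite /inst /= !tsubE => /pImpE; apply; exact: prf_hd.
rewrite !seg_funE -/Del segS //; apply: App_proper => //; apply: App_proper => //.
by apply: prF_proper.
Qed.

Definition LIN_context G (Gam : seq (fm G)) mu Y Xi : Prop :=
  oracles Gam mu Y /\ List.In (LINF Xi) Gam.

Lemma LIN_context_cons G (Gam : seq (fm G)) mu Y Xi A :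
  LIN_context Gam mu Y Xi -> LIN_context (A :: Gam) mu Y Xi.
Proof. by case; split; [apply: oracles_cons | right]. Qed.

Lemma LIN_context_fwk G (Gam : seq (fm G)) mu Y Xi t :
  LIN_context Gam mu Y Xi ->
  LIN_context (map (fwk t) Gam) (twk t mu) (twk t Y) (twk t Xi).
Proof.
have e : fwk t (LINF Xi) = LINF (twk t Xi).
  by rewrite /fwk /LINF /= !(twk_tsub, tsubE).
case=> orc /(List.in_map (fwk t)); rewrite e; split=> //; exact: oracles_fwk.
Qed.

Definition has_branchF G (f : tm G ty1) : fm G :=
  Ex ty1 (branchF (twk _ f) (Var V0)).

Lemma LINFE G (Gam : seq (fm G)) Xi Psi g C :
  Gam ⊢ LINF Xi ->
  let h := twk ty0 Xi ⋅ twk ty0 Psi ⋅ Var V0 in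
  cylF h (twk ty0 Psi ⋅ h) (twk ty0 g) :: map (fwk ty0) Gam ⊢ fwk ty0 C ->
  Gam ⊢ C.
Proof.
move=> /(@pAllE _ _ _ _ _ Psi) /(@pAllE _ _ _ _ _ g).
rewrite /inst /= !(twk_tsub, tsubE) /= => ex.
exact: pExE ex.
Qed.

Lemma cover_val_Suslin G (Gam : seq (fm G)) mu Y Xi f n : oracles Gam mu Y ->
  eqv Gam (cover_val mu Y Xi f n) Zero ->
  eqv Gam (Suslin_tm mu Y Xi ⋅ f) Zero.
Proof.
move=> orc e; rewrite Suslin_tmE; apply/om_om0/(mu_zero orc (n := n)).
by rewrite cover_funE.
Qed.

Lemma Suslin_cover_val G (Gam : seq (fm G)) mu Y Xi f :
  eqv Gam (Suslin_tm mu Y Xi ⋅ f) Zero ->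
  eqv Gam (cover_val mu Y Xi f (mu ⋅ cover_fun mu Y Xi f)) Zero.
Proof.
rewrite Suslin_tmE -cover_funE /Suslin_val => e.
(* Either the value x is 0, as wanted, or 1 - x = 0; in the latter case 1 - (1 - x) would be 1,
   against [e]. *)
apply: pOrE (om_cases Gam _) (prf_hd _ _) _.
apply: om_eq0; [exact: prf_hd | exact/prf_cons/e].
Qed.

Lemma branchF_Suslin G (Gam : seq (fm G)) mu Y Xi f g :
  LIN_context Gam mu Y Xi -> Gam ⊢ branchF f g ->
  eqv Gam (Suslin_tm mu Y Xi ⋅ f) Zero.
Proof.
move=> ctx free; apply: prf_cut free _.
have [_ /(@pHyp theoryLIN) inXi] := LIN_context_cons (branchF f g) ctx.
apply: (LINFE (Psi := leaf_search mu Y f) (g := g) inXi).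
rewrite /twk tsub_leaf_search /fwk /= tsub_Suslin_tm -!/(twk _ _).
set h := _ ⋅ _ ⋅ _; pose Psi := leaf_search (twk ty0 mu) (twk _ Y) (twk _ f).
pose C := cylF h (Psi ⋅ h) (twk _ g).
pose Del := C :: map (fwk ty0) (branchF f g :: Gam).
have [orc _] : LIN_context Del (twk _ mu) (twk _ Y) (twk _ Xi).
  exact/LIN_context_cons/LIN_context_fwk/LIN_context_cons.
(* [Var V0] is the index of the neighbourhood that contains g. Its centre h shares with g the
   segment of length [Psi ⋅ h], on which f vanishes. *)
apply: (cover_val_Suslin (n := Var V0) orc); rewrite /cover_val.
rewrite (cylF_seg (k := Psi ⋅ h) orc (prf_hd _ _)); apply: branchFE => //.
have <- : fwk ty0 (branchF f g) = branchF (twk _ f) (twk _ g).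
  by rewrite /fwk /branchF /= !(twk_tsub, tsubE).
by apply: pHyp; right; left.
Qed.

Lemma cover_val_branchF G (Gam : seq (fm G)) mu Y Xi f n : oracles Gam mu Y ->
  eqv Gam (cover_val mu Y Xi f n) Zero ->
  Gam ⊢ branchF f (candidate mu Y Xi f n).
Proof.
move=> orc e; move eg: (candidate mu Y Xi f n) => g.
apply: prf_cut e _; apply: pAllI.
rewrite [map _ _]/=.
have -> : fwk ty0 (cover_val mu Y Xi f n ≐ Zero) =
    (cover_val (twk _ mu) (twk _ Y) (twk _ Xi) (twk _ f) (twk _ n) ≐ Zero).
  by rewrite -[twk _ mu]/(tsub _ mu) -tsub_cover_val.
set c := cover_val _ _ _ _ _; pose Del := (c ≐ Zero) :: map (fwk ty0) Gam.
have orc' : oracles Del (twk _ mu) (twk _ Y) by apply/oracles_cons/oracles_fwk.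
have eh : twk ty0 g =
    candidate (twk _ mu) (twk _ Y) (twk _ Xi) (twk _ f) (twk _ n).
  by rewrite -eg /twk /candidate /= tsub_leaf_search.
set h := candidate (twk _ mu) _ _ _ _ in eh.
pose k := leaf_search (twk ty0 mu) (twk _ Y) (twk _ f) ⋅ h.
have e : eqv Del (twk _ f ⋅ seg (twk _ mu) (twk _ Y) h k) Zero by apply: prf_hd.
apply: (@pExI _ _ _ _ _ (seg (twk _ mu) (twk _ Y) h (Var V0))).
rewrite /inst [fsub _ _]/= !tsubE -/Del eh.
apply: pAndI; first exact: initF_seg.
set x := _ ⋅ _.
(* If f is nonzero on the segment of length [Var V0], that length is a zero of [leaf_test]. Then
   [mu] also yields a zero, namely [k], where f was assumed to vanish. *)
apply: pOrE (om_cases Del x) (prf_hd _ _) _.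
set B := _ ≐ _.
apply: (om_eq0 (x := twk _ f ⋅ seg (twk _ mu) (twk _ Y) h k)); first exact: prf_cons.
rewrite -leaf_testE /k leaf_searchE.
apply: (mu_zero (oracles_cons B orc') (n := Var V0)).
by rewrite leaf_testE; apply: prf_hd.
Qed.

Lemma le0_congr G (Gam : seq (fm G)) a a' b b' :
  eqv Gam a a' -> eqv Gam b b' -> Gam ⊢ le0 a b -> Gam ⊢ le0 a' b'.
Proof.
move=> ea eb /pOrE; apply.
  by apply/pOrI1/(prf_Lt_congr _ _ (prf_hd _ _)); apply: prf_cons.
by apply/pOrI2/(prf_Eq_congr _ _ (prf_hd _ _)); apply: prf_cons.
Qed.

Lemma has_branchF_Suslin G (Gam : seq (fm G)) mu Y Xi f :
  LIN_context Gam mu Y Xi -> Gam ⊢ has_branchF f ->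
  eqv Gam (Suslin_tm mu Y Xi ⋅ f) Zero.
Proof.
move=> ctx /pExE; apply; rewrite /fwk /= tsub_Suslin_tm.
apply: (branchF_Suslin (g := Var V0)); last exact: prf_hd.
exact/LIN_context_cons/LIN_context_fwk.
Qed.

Lemma Suslin_has_branchF G (Gam : seq (fm G)) mu Y Xi f :
  LIN_context Gam mu Y Xi -> eqv Gam (Suslin_tm mu Y Xi ⋅ f) Zero ->
  Gam ⊢ has_branchF f.
Proof.
case=> orc _ /Suslin_cover_val /(cover_val_branchF orc).
move: (candidate _ _ _ _ _) => g free.
apply: (@pExI _ _ _ _ _ g); rewrite /inst /= !tsubE.
exact: free.
Qed.

Lemma LIN_context_S2F G (Gam : seq (fm G)) mu Y Xi :
  LIN_context Gam mu Y Xi -> Gam ⊢ S2F G.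
Proof.
move=> ctx; apply: (@pExI _ _ _ _ _ (Suslin_tm mu Y Xi)).
rewrite /inst /=; apply: pAndI; apply: pAllI.
  apply: (le0_congr _ _ (om_le1 (map (fwk ty1) Gam) _)).
    rewrite /twk tsub_Suslin_tm; symmetry; apply: Suslin_tmE.
  by symmetry; apply/prf_ax/Pi_def.
have := LIN_context_fwk ty1 ctx.
(* The shifted oracles are generalized; from here on only their properties in the new context
   matter. *)
rewrite /twk tsub_Suslin_tm; move: (map _ _) (tsub _ mu) (tsub _ Y) (tsub _ Xi).
move=> Del nu Z Ups {}ctx.
have fwd : has_branchF (Var V0) :: Del ⊢ Suslin_tm nu Z Ups ⋅ Var V0 ≐ Zero.
  by apply: has_branchF_Suslin (prf_hd _ _); apply: LIN_context_cons.
have bwd : (Suslin_tm nu Z Ups ⋅ Var V0 ≐ Zero) :: Del ⊢ has_branchF (Var V0).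
  by apply: Suslin_has_branchF (prf_hd _ _); apply: LIN_context_cons.
exact: pAndI (pImpI fwd) (pImpI bwd).
Qed.

Lemma S2F_derivable : proves theoryLIN (S2F [::]).
Proof.
have axXi : [::] ⊢ exLINF [::] by apply: pAx; right.
apply: pExE axXi _.
have axmu Gam : Gam ⊢ mu2F [:: tyLIN] by apply: pAx; left; right.
apply: pExE (axmu _) _; apply: pExE (eqcharF_ex _) _.
(* After the three eliminations the variables are, from the innermost, [Y], [mu] and [Xi]. *)
apply: (@LIN_context_S2F _ _ (Var (VS V0)) (Var V0) (Var (VS (VS V0)))).
split; last by right; right; left.
by split; [right; left | left].
Qed.

Theorem theorem4p13 :
  (exists e : nat,
     forall (mu : itp ty2) (Xi : itp tyLIN) (Su : itp ty2),
       is_mu mu -> LIN Xi -> is_Suslin Su ->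
       forall f : itp ty1,
         kleene e [:: Obj ty1 f; Obj ty2 mu; Obj tyLIN Xi] (Su f)) /\
  proves (extend ACA0w exLINF) (S2F [::]).
Proof.
split; last exact: S2F_derivable.
have [e ke] := computable_Suslin; exists e => mu Xi Su muP XiP SuP f.
by rewrite -(Suslin_ofE f muP XiP SuP).
Qed.
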